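(* Let $D$ be a weakly locally finite division ring with center $F$ and let $G$ be an almost subnormal subgroup of $D^*$. If $G$ is soluble-by-periodic, then $G$ is central, i.e. $G\subseteq F^*$.
   Context: A division ring $D$ is weakly locally finite if every finite subset of $D$ generates a division subring that is finite-dimensional over its own center. A group $G$ is soluble-by-periodic if it has a soluble normal subgroup $H$ such that every element of $G/H$ has finite order. A subgroup $H$ of a group $K$ is almost subnormal in $K$ if there is a chain of subgroups $H=H_r\le H_{r-1}\le\cdots\le H_1=K$ such that for each $1<i\le r$, either $H_i$ is normal in $H_{i-1}$ or $H_i$ has finite index in $H_{i-1}$. *)

(* Defs.v *)
From mathcomp Require Import all_boot all_algebra.
Set Implicit Arguments. Unset Strict Implicit. Unset Printing Implicit Defensive.
Import GRing.Theory.
Local Open Scope ring_scope.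

Definition is_division_ring (D : unitRingType) : Prop :=
  forall x : D, x != 0 -> x \is a GRing.unit.

Definition units_of (D : unitRingType) : D -> Prop := fun x => x \is a GRing.unit.

Definition unit_subgroup (D : unitRingType) (G : D -> Prop) : Prop :=
  G 1 /\ (forall x, G x -> x \is a GRing.unit) /\
  (forall x y, G x -> G y -> G (x * y)) /\ (forall x, G x -> G x^-1).

Definition subgroup_of (D : unitRingType) (H K : D -> Prop) : Prop :=
  unit_subgroup H /\ (forall x, H x -> K x).

Definition normal_in (D : unitRingType) (H K : D -> Prop) : Prop :=
  forall h k, H h -> K k -> H (k^-1 * h * k).

Definition finite_index (D : unitRingType) (H K : D -> Prop) : Prop :=
  exists s : seq D, (forall y, y \in s -> K y) /\
    forall x, K x -> exists2 y, y \in s & H (y^-1 * x).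

Definition almost_subnormal (D : unitRingType) (H K : D -> Prop) : Prop :=
  exists (r : nat) (C : nat -> D -> Prop),
    C 0%N = K /\ C r = H /\
    forall i, (i < r)%N -> subgroup_of (C i.+1) (C i) /\
      (normal_in (C i.+1) (C i) \/ finite_index (C i.+1) (C i)).

Definition soluble_group (D : unitRingType) (H : D -> Prop) : Prop :=
  unit_subgroup H /\
  exists (n : nat) (S : nat -> D -> Prop),
    S 0%N = H /\ (forall x, S n x <-> x = 1) /\
    forall i, (i < n)%N -> subgroup_of (S i.+1) (S i) /\ normal_in (S i.+1) (S i) /\
      (forall x y, S i x -> S i y -> S i.+1 (x^-1 * y^-1 * x * y)).

Definition soluble_by_periodic (D : unitRingType) (G : D -> Prop) : Prop :=
  exists H : D -> Prop, subgroup_of H G /\ normal_in H G /\ soluble_group H /\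
    forall g, G g -> exists n : nat, (0 < n)%N /\ H (g ^+ n).

Definition divring_closed (D : unitRingType) (K : D -> Prop) : Prop :=
  K 0 /\ K 1 /\ (forall x, K x -> K (- x)) /\
  (forall x y, K x -> K y -> K (x + y)) /\
  (forall x y, K x -> K y -> K (x * y)) /\
  (forall x, K x -> x != 0 -> K x^-1).

Definition gen_divring (D : unitRingType) (S : seq D) : D -> Prop :=
  fun x => forall K : D -> Prop, divring_closed K -> (forall s, s \in S -> K s) -> K x.

Definition center_of (D : unitRingType) (K : D -> Prop) : D -> Prop :=
  fun z => K z /\ forall k, K k -> z * k = k * z.

Definition findim_over_center (D : unitRingType) (K : D -> Prop) : Prop :=
  exists b : seq D, (forall y, y \in b -> K y) /\
    forall k, K k -> exists c : seq D, size c = size b /\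
      (forall z, z \in c -> center_of K z) /\
      k = \sum_(i < size b) c`_i * b`_i.

Definition weakly_locally_finite (D : unitRingType) : Prop :=
  forall S : seq D, findim_over_center (gen_divring S).

(* Main.v *)
From HB Require Import structures.
Require Import Defs.
From mathcomp Require Import all_boot all_algebra all_field.
From mathcomp Require Import boolp classical_sets ring zify.
Set Implicit Arguments. Unset Strict Implicit. Unset Printing Implicit Defensive.
Import GRing.Theory.
Local Open Scope ring_scope.

(**
Descending along the derived series of the soluble normal subgroup, it suffices
to treat an almost subnormal subgroup X in which every commutator has a central
power.  Passing to the division subring generated by some a in X and an arbitrary
x, the division ring A is finite-dimensional over its center F.

Suppose that a in X is not central and let D b = b - a^-1 b a.  If D is nilpotent,
then a^-1 x a = x + 1 for some x, which is impossible.  In characteristic 0, an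
inner derivation sends a to 1, hence the minimal polynomial of a to a smaller one.
In characteristic p, x can be chosen transcendental over F_p, and taking powers and
commutators with a turns x into a product of (x - j)^(E j), j in F_p, lying in X.
The exponent E stays nonconstant, because a difference E j - E (j + 1) has sum zero
over F_p, whereas a central power of a commutator forces a constant exponent.

To see that D is nilpotent, take s in F such that 1/s is not in Z[s]: s = 2 in
characteristic 0, s transcendental over F_p in characteristic p; if there is no
such s, A is commutative by Wedderburn's theorem.  A subring O of F maximal among
those containing s but not 1/s is a valuation ring, and A contains an O-lattice L
closed under products.  An element z of 1 + s^2 L with a central power z^n is
central, up to p-th powers, which the first part handles.  Descending the almost
subnormal chain from 1 + t b with t -> 0 in F, one finds in X elements
1 + t (D^k b + o(1)).  Their commutators with a are central, so D^(k+1) b is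
central for every b and D^(k+2) = 0.
*)

(** * Valuation rings by maximality *)

Record is_valuation_ring (F : fieldType) (s : F) (O : F -> Prop) : Prop := {
  val1 : O 1;
  valB : forall x y, O x -> O y -> O (x - y);
  valM : forall x y, O x -> O y -> O (x * y);
  val_s : O s;
  val_sV : ~ O s^-1;
  val_total : forall x, x != 0 -> O x \/ O x^-1 }.

Section ValuationRing.
Variables (F : fieldType) (s : F).
Hypothesis s_neq0 : s != 0.

(* The empty set is allowed, so that the union of the empty chain qualifies in Zorn's lemma. *)
Definition partial_ring (O : set F) : Prop :=
  (forall x, O x -> O 1 /\ O s) /\
  (forall x y, O x -> O y -> O (x - y) /\ O (x * y)) /\ ~ O s^-1.

Lemma maximal_partial_ring :
  (forall f : {poly int}, (map_poly intr f).[s] != s^-1) ->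
  exists O : set F, [/\ partial_ring O, O 1 &
    forall B, (O `<=` B)%classic -> partial_ring B -> (B `<=` O)%classic].
Proof.
move=> sV.
pose Zs : set F := fun x => exists f : {poly int}, x = (map_poly intr f).[s].
have ZsP : partial_ring Zs.
  split=> [x _|].
    split; first by exists 1; rewrite rmorph1 hornerC.
    by exists 'X; rewrite map_polyX hornerX.
  split=> [_ _ [f ->] [g ->]|[f /esym/eqP]]; last by rewrite (negbTE (sV f)).
  split; first by exists (f - g); rewrite rmorphB hornerD hornerN.
  by exists (f * g); rewrite rmorphM hornerM.
have [C CP|O [OP Omax]] := @Zorn_bigcup _ partial_ring.
  move=> Ctot; split=> [x [X CX Xx]|].
    by have [/(_ x Xx) [X1 Xs] _] := CP _ CX; split; exists X.
  split=> [x y [X CX Xx] [Y CY Yy]|[X CX]]; last by case: (CP _ CX) => _ [].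
  have [XY|YX] := Ctot X Y CX CY.
    have [_ [/(_ x y (XY x Xx) Yy) [? ?] _]] := CP _ CY.
    by split; exists Y.
  have [_ [/(_ x y Xx (YX y Yy)) [? ?] _]] := CP _ CX.
  by split; exists X.
have Omax' B : (O `<=` B)%classic -> partial_ring B -> (B `<=` O)%classic.
  move=> OB BP; have [BO|nBO] := pselect (B `<=` O)%classic; first exact: BO.
  by case: (Omax B (conj OB nBO) BP).
exists O; split=> //.
(* Zorn's lemma may return the empty set; it lies in [Zs], so maximality still gives [Zs] inside
   [O], and hence [O 1]. *)
have [[x Ox]|nO] := pselect (exists x, O x); first by case: (OP.1 _ Ox).
have /Omax' : (O `<=` Zs)%classic by move=> x Ox; case: nO; exists x.
by apply=> //; exists 1; rewrite rmorph1 hornerC.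
Qed.

Section Maximal.
Variable O : set F.
Hypotheses (OP : partial_ring O) (O1 : O 1).
Hypothesis Omax : forall B, (O `<=` B)%classic -> partial_ring B -> (B `<=` O)%classic.

Let OB x y : O x -> O y -> O (x - y). Proof. by move=> Ox Oy; case: (OP.2.1 x y Ox Oy). Qed.
Let OM x y : O x -> O y -> O (x * y). Proof. by move=> Ox Oy; case: (OP.2.1 x y Ox Oy). Qed.
Let Os : O s. Proof. by case: (OP.1 1 O1). Qed.
Let OsV : ~ O s^-1. Proof. by case: OP => _ []. Qed.
Let O0 : O 0. Proof. by rewrite -(subrr 1); apply: OB. Qed.
Let ON x : O x -> O (- x). Proof. by move=> Ox; rewrite -sub0r; apply: OB. Qed.
Let OD x y : O x -> O y -> O (x + y).
Proof. by move=> Ox Oy; rewrite -[y]opprK; apply: OB => //; apply: ON. Qed.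
Let OX x n : O x -> O (x ^+ n).
Proof. by move=> Ox; elim: n => [|n IHn]; rewrite ?expr0 // exprS; apply: OM. Qed.
Let Osum I (r : seq I) (P : pred I) (E : I -> F) :
  (forall i, P i -> O (E i)) -> O (\sum_(i <- r | P i) E i).
Proof. by move=> OE; elim/big_ind: _ => //; apply: OD. Qed.

(** Otherwise [O[x]] would still avoid [s^-1], and maximality would put [x] in [O]. *)
Lemma maximal_adjoin x : ~ O x ->
  exists2 f : {poly F}, (forall i, O f`_i) & s * f.[x] = 1.
Proof.
move=> nOx; apply: contrapT => nf; apply: nOx.
pose B : set F := fun y => exists2 f : {poly F}, (forall i, O f`_i) & y = f.[x].
apply: (Omax (B := B)).
- move=> c Oc; exists c%:P; last by rewrite hornerC.
  by move=> i; rewrite coefC; case: ifP.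
- split=> [_ _|].
    split; first by exists 1; rewrite ?hornerC // => i; rewrite coefC; case: ifP.
    by exists s%:P; rewrite ?hornerC // => i; rewrite coefC; case: ifP.
  split=> [_ _ [f Of ->] [g Og ->]|[f Of sf]]; last first.
    by apply: nf; exists f; rewrite // -sf divff.
  split; first by exists (f - g); rewrite ?hornerD ?hornerN // => i; rewrite coefB; apply: OB.
  exists (f * g); rewrite ?hornerM // => i; rewrite coefM.
  by apply: Osum => j _; apply: OM.
- by exists 'X; rewrite ?hornerX // => i; rewrite coefX; case: (i == 1)%N.
Qed.

(** This puts [s] in the Jacobson radical of [O]. If the inverse of [w = 1 - s b] is not in [O],
    then [s f(w^-1) = 1]; multiplying by a power of [w] puts that power in [s O], while every power
    of [w] is in [1 + s O], so [s^-1] would be in [O]. *)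
Lemma maximal_unit b : O b -> O (1 - s * b)^-1.
Proof.
move=> Ob; set w := 1 - s * b.
have Ow : O w by apply: OB => //; apply: OM.
have w0 : w != 0.
  apply/eqP => /eqP; rewrite subr_eq0 => /eqP sb.
  by apply: OsV; rewrite -[s^-1]mulr1 sb mulKf.
have powE n : exists2 c, O c & w ^+ n = 1 - s * c.
  elim: n => [|n [c Oc IHn]]; first by exists 0; rewrite // mulr0 subr0.
  exists (b * w ^+ n + c); first by apply: OD => //; apply: OM => //; apply: OX.
  by rewrite exprS mulrDr opprD addrCA -IHn addrC {1}/w mulrBl mul1r mulrA.
apply: contrapT => /maximal_adjoin [f Of sf].
have [c Oc wE] := powE (size f).
apply: OsV; have -> : s^-1 = \sum_(i < size f) f`_i * w ^+ (size f - i) + c.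
  apply: (mulfI s_neq0); rewrite divff // mulrDr.
  have -> : s * (\sum_(i < size f) f`_i * w ^+ (size f - i)) = w ^+ size f.
    rewrite -[RHS]mulr1 -sf horner_coef [RHS]mulrCA; congr (_ * _).
    rewrite mulr_sumr; apply: eq_bigr => i _.
    by rewrite [RHS]mulrCA exprVn -expfB_cond // (negPf w0) add0n ltnW.
  by rewrite wE subrK.
apply: OD => //; apply: Osum => i _; apply: OM => //; exact: OX.
Qed.

(** Descent on the total degree [n + k] of the two relations: the one of lower degree is used to
    eliminate the top term of the other. In degree 0 a relation says that [s^-1] is in [O]. *)
Lemma maximal_no_adjoin N x n k (f g : {poly F}) :
  x != 0 -> (n + k <= N)%N -> (size f <= n.+1)%N -> (size g <= k.+1)%N ->
  (forall i, O f`_i) -> (forall i, O g`_i) ->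
  s * f.[x] = 1 -> s * g.[x^-1] = 1 -> False.
Proof.
have const (h : {poly F}) y :
    (forall i, O h`_i) -> s * h.[y] = 1 -> (size h <= 1)%N -> False.
  move=> Oh sh sz; apply: OsV; have := sh; rewrite (size1_polyC sz) hornerC => E.
  by rewrite -[s^-1]mulr1 -E mulKf.
elim: N x n k f g => [|N IHN] x n k f g x0 nkN szf szg Of Og fx gx.
  move: nkN szg; rewrite leqn0 addn_eq0 => /andP[_ /eqP->] sz.
  exact: (const g _ Og gx sz).
wlog kn : x n k f g x0 nkN szf szg Of Og fx gx / (k <= n)%N.
  move=> WL; case: (leqP k n) => [kn|/ltnW nk]; first exact: (WL x n k f g).
  by apply: (WL x^-1 k n g f); rewrite ?invr_eq0 ?invrK // addnC.
case: k nkN szg kn => [|k] nkN szg kn; first exact: (const g _ Og gx szg).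
case: n nkN szf kn => // n nkN szf kn.
(* Multiply [s g(x^-1) = 1] by [x ^+ k.+1] and divide by [1 - s g_0], a unit of [O]. *)
have [w Ow wE] : exists2 w, O w & x ^+ k.+1 = w * (s * \sum_(i < k.+1) g`_i.+1 * x ^+ (k - i)).
  exists (1 - s * g`_0)^-1; first exact: maximal_unit.
  have w0 : 1 - s * g`_0 != 0.
    apply/eqP => /eqP; rewrite subr_eq0 => /eqP sb.
    by apply: OsV; rewrite -[s^-1]mulr1 sb mulKf.
  apply: (mulfI w0); rewrite mulVKf // mulrBl mul1r -{1}[x ^+ _]mul1r -{1}gx.
  rewrite (horner_coef_wide _ szg) big_ord_recl expr0 mulr1 mulrDr mulrDl addrAC subrr add0r.
  rewrite -mulrA mulr_suml; congr (_ * _); apply: eq_bigr => i _.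
  by rewrite -mulrA lift0 exprVn [_^-1 * _]mulrC -expfB_cond  ?(negPf x0) ?add0n ?subSS.
(* The top term of [f] is rewritten through [x ^+ n.+1 = x ^+ (n - k) * x ^+ k.+1], which leaves
   degree at most [n]. *)
pose h := \poly_(i < n.+1) f`_i + (f`_n.+1 * w * s) *:
  \sum_(i < k.+1) g`_i.+1 *: 'X^(n - i).
apply: (IHN x n k.+1 h g) => //.
- rewrite (leq_trans (size_polyD _ _)) // geq_max size_poly /=.
  apply: leq_trans (size_scale_leq _ _) _.
  apply: (leq_trans (size_sum _ _ _)); apply/bigmax_leqP => i _.
  by apply: leq_trans (size_scale_leq _ _) _; rewrite size_polyXn ltnS leq_subr.
- move=> i; rewrite coefD coef_poly coefZ coef_sum; apply: OD; first by case: ifP.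
  apply: OM; first by apply: OM => //; apply: OM.
  apply: Osum => j _; rewrite coefZ coefXn; apply: OM => //.
  by case: eqP.
- rewrite -fx (horner_coef_wide _ szf) big_ord_recr /= hornerD; congr (s * (_ + _)).
    by rewrite horner_poly.
  rewrite hornerZ -!mulrA; congr (_ * _).
  rewrite -(subnKC kn) exprD [in RHS]wE -!mulrA; congr (_ * (_ * _)).
  rewrite horner_sum mulr_suml; apply: eq_bigr => i _.
  rewrite hornerZ hornerXn -mulrA -exprD; congr (_ * _ ^+ _).
  by rewrite subSS addnC addnBA ?subnK // -ltnS.
Qed.

Lemma maximal_is_valuation_ring : is_valuation_ring s O.
Proof.
split=> // x x0.
have [|nOx] := pselect (O x); first by left.
have [|nOxV] := pselect (O x^-1); first by right.
have [f Of sf] := maximal_adjoin nOx; have [g Og sg] := maximal_adjoin nOxV.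
case: (@maximal_no_adjoin (size f + size g) x (size f) (size g) f g) => //.
Qed.

End Maximal.

Lemma valuation_ring_exists :
  (forall f : {poly int}, (map_poly intr f).[s] != s^-1) ->
  exists O, is_valuation_ring s O.
Proof.
move=> /maximal_partial_ring [O [OP O1 Omax]].
by exists O; apply: maximal_is_valuation_ring.
Qed.

End ValuationRing.

(** * Lattices over a valuation ring *)

Section ValuationRingTheory.
Variables (F : fieldType) (s : F) (O : F -> Prop).
Hypothesis OV : is_valuation_ring s O.

Lemma val0 : O 0. Proof. by rewrite -(subrr 1); apply: (valB OV); apply: val1 OV. Qed.
Lemma valN x : O x -> O (- x).
Proof. by move=> Ox; rewrite -sub0r; apply: (valB OV) => //; apply: val0. Qed.
Lemma valD x y : O x -> O y -> O (x + y).
Proof. by move=> Ox Oy; rewrite -[y]opprK; apply: (valB OV) => //; apply: valN. Qed.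
Lemma val_nat n : O n%:R.
Proof.
elim: n => [|n IHn]; first exact: val0.
by rewrite -addn1 natrD; apply: valD => //; apply: val1 OV.
Qed.
Lemma val_sum I (r : seq I) (P : pred I) (E : I -> F) :
  (forall i, P i -> O (E i)) -> O (\sum_(i <- r | P i) E i).
Proof. by move=> OE; elim/big_ind: _ => //; [apply: val0|apply: valD]. Qed.
Lemma val_tot x : O x \/ O x^-1.
Proof. by case: (eqVneq x 0) => [->|/(val_total OV) //]; left; apply: val0. Qed.
Lemma val_s_neq0 : s != 0.
Proof. by apply/eqP => s0; case: (val_sV OV); rewrite s0 invr0; apply: val0. Qed.

(** Divisibility with respect to [O] is total, so among finitely many coordinates, not all zero, one
    divides all the others. *)
Lemma dominant_coordinate n (c : 'I_n -> F) :
  (exists i, c i != 0) -> exists2 m, c m != 0 & forall i, O (c i / c m).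
Proof.
elim: n c => [|n IHn] c [i0 ci0]; first by case: i0 ci0.
case: (pselect (exists i, c (lift ord0 i) != 0)) => [/IHn [m cm Om]|nc].
  have [Oc|Oc] := val_tot (c ord0 / c (lift ord0 m)).
    exists (lift ord0 m) => // i; case: (unliftP ord0 i) => [j ->|-> //].
    exact: Om.
  have [c0|c0] := eqVneq (c ord0) 0.
    exists (lift ord0 m) => // i; case: (unliftP ord0 i) => [j ->|->]; first exact: Om.
    by rewrite c0 mul0r; apply: val0.
  exists ord0 => // i; case: (unliftP ord0 i) => [j ->|->]; last first.
    by rewrite divff //; apply: val1 OV.
  have -> : c (lift ord0 j) / c ord0 = (c (lift ord0 j) / c (lift ord0 m)) *
      (c ord0 / c (lift ord0 m))^-1 by rewrite invf_div mulrA divfK.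
  exact: (valM OV).
have c0 i : c (lift ord0 i) = 0.
  by apply: contrapT => ci; apply: nc; exists i; apply/eqP.
have cO : c ord0 != 0 by case: (unliftP ord0 i0) ci0 => [j ->|-> //]; rewrite c0 eqxx.
exists ord0 => // i; case: (unliftP ord0 i) => [j ->|->].
  by rewrite c0 mul0r; apply: val0.
by rewrite divff //; apply: val1 OV.
Qed.

Lemma common_denominator (I : finType) (c : I -> F) :
  exists2 e, e != 0 & forall i, O (e * c i).
Proof.
case: (pselect (exists i, c i != 0)) => [[i ci]|nc]; last first.
  exists 1 => [|i]; first exact: oner_neq0.
  suff -> : c i = 0 by rewrite mulr0; apply: val0.
  by apply: contrapT => ci; apply: nc; exists i; apply/eqP.
have [|m cm Om] := @dominant_coordinate #|I| (fun j => c (enum_val j)).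
  by exists (enum_rank i); rewrite enum_rankK.
exists (c (enum_val m))^-1 => [|j]; first by rewrite invr_eq0.
by have := Om (enum_rank j); rewrite enum_rankK mulrC.
Qed.

End ValuationRingTheory.

(** A nontrivial relation lets one generator be dropped, so induction on their number ends with a
    free family. *)
Lemma basis_exists (F : fieldType) (A : lmodType F) :
  (exists n (b : 'I_n -> A), forall x, exists c : 'I_n -> F, x = \sum_i c i *: b i) ->
  exists n (b : 'I_n -> A), (forall x, exists c : 'I_n -> F, x = \sum_i c i *: b i) /\
    forall c : 'I_n -> F, \sum_i c i *: b i = 0 -> forall i, c i = 0.
Proof.
case=> n; elim: n => [|n IHn] [b bS].
  by exists 0%N, b; split=> // c _ i; case: i.
case: (pselect (exists c : 'I_n.+1 -> F, \sum_i c i *: b i = 0 /\ exists i, c i != 0)); last first.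
  move=> nc; exists n.+1, b; split=> // c c0 i; apply: contrapT => /eqP ci.
  by apply: nc; exists c; split=> //; exists i.
case=> c [c0 [j cj]]; apply: IHn; exists (b \o lift j) => x.
have [a ->] := bS x.
exists (fun i => a (lift j i) - a j / c j * c (lift j i)).
have bj : c j *: b j = - \sum_i c (lift j i) *: b (lift j i).
  by apply/eqP; rewrite -addr_eq0 -(bigD1_ord j (P := predT) (F := fun i => c i *: b i)) // c0.
rewrite (bigD1_ord j) //=.
have -> : a j *: b j = (a j / c j) *: (c j *: b j) by rewrite scalerA divfK.
rewrite bj scalerN scaler_sumr addrC -sumrB; apply: eq_bigr => i _.
by rewrite scalerBl scalerA.
Qed.

Record is_lattice (F : fieldType) (A : unitAlgType F) (O : F -> Prop) (L : A -> Prop) : Prop := {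
  latB : forall x y, L x -> L y -> L (x - y);
  latZ : forall c x, O c -> L x -> L (c *: x);
  latM : forall x y, L x -> L y -> L (x * y);
  (* [c v] is primitive: [L] meets its line exactly in [O c v]. *)
  lat_primitive : forall v, v != 0 ->
    exists2 c, c != 0 & forall d, L (d *: (c *: v)) <-> O d }.

(** [L] is [e] times the [O]-span of a basis, where [e] clears the denominators of the structure
    constants; this makes [L] closed under products. A primitive multiple of [v] comes from dividing
    by a dominant coordinate and multiplying by [e]. *)
Lemma lattice_exists (F : fieldType) (s : F) (A : unitAlgType F) (O : F -> Prop) :
  is_valuation_ring s O ->
  (exists n (b : 'I_n -> A), forall x, exists c : 'I_n -> F, x = \sum_i c i *: b i) ->
  exists L : A -> Prop, is_lattice O L.
Proof.
move=> OV /basis_exists [n [b [bS bF]]].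
have [c cE] : exists c : 'I_n * 'I_n -> 'I_n -> F,
    forall i j, b i * b j = \sum_k c (i, j) k *: b k.
  have /choice [c cE] := fun ij : 'I_n * 'I_n => bS (b ij.1 * b ij.2).
  by exists c => i j; rewrite -cE.
have [e e0 Oe] := common_denominator OV (fun ijk : 'I_n * 'I_n * 'I_n => c ijk.1 ijk.2).
pose L (x : A) := exists2 o : 'I_n -> F, (forall i, O (o i)) & x = e *: \sum_i o i *: b i.
exists L; split.
- move=> _ _ [o Oo ->] [o' Oo' ->]; exists (fun i => o i - o' i).
    by move=> i; apply: (valB OV).
  by rewrite -scalerBr -sumrB; congr (_ *: _); apply: eq_bigr => i _; rewrite scalerBl.
- move=> d _ Od [o Oo ->]; exists (fun i => d * o i).
    by move=> i; apply: (valM OV).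
  rewrite scalerA mulrC -scalerA; congr (_ *: _); rewrite scaler_sumr.
  by apply: eq_bigr => i _; rewrite scalerA.
- move=> _ _ [o Oo ->] [o' Oo' ->].
  exists (fun k => \sum_i \sum_j (o i * o' j) * (e * c (i, j) k)).
    move=> k; apply: (val_sum OV) => i _; apply: (val_sum OV) => j _.
    by apply: (valM OV); [apply: (valM OV)|apply: (Oe (i, j, k))].
  rewrite -scalerAl -scalerAr; congr (_ *: _).
  rewrite mulr_suml scaler_sumr.
  under [RHS]eq_bigr => k _ do rewrite scaler_suml.
  rewrite [RHS]exchange_big /=; apply: eq_bigr => i _.
  rewrite mulr_sumr scaler_sumr.
  under [RHS]eq_bigr => k _ do rewrite scaler_suml.
  rewrite [RHS]exchange_big /=; apply: eq_bigr => j _.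
  rewrite -scalerAl -scalerAr cE !scaler_sumr; apply: eq_bigr => k _.
  by rewrite !scalerA; congr (_ *: _); ring.
- move=> v v0; have [a vE] := bS v.
  have [|m am Om] := @dominant_coordinate _ _ _ OV _ a.
    apply: contrapT => na; case/eqP: v0; rewrite vE big1 // => i _.
    suff -> : a i = 0 by rewrite scale0r.
    by apply: contrapT => ai; apply: na; exists i; apply/eqP.
  exists (e / a m) => [|d]; first by rewrite mulf_neq0 // invr_eq0.
  have dE : d *: ((e / a m) *: v) = e *: \sum_i (d * (a i / a m)) *: b i.
    rewrite vE !scaler_sumr; apply: eq_bigr => i _; rewrite !scalerA; congr (_ *: _).
    by rewrite mulrCA -!mulrA; congr (_ * (_ * _)); rewrite mulrC.
  split=> [|Od]; last first.
    by exists (fun i => d * (a i / a m)); rewrite // => i; apply: (valM OV).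
  rewrite dE => -[o Oo /(scalerI e0) /eqP]; rewrite -subr_eq0 -sumrB => /eqP E.
  have /bF/(_ m)/eqP : \sum_i (d * (a i / a m) - o i) *: b i = 0.
    by rewrite -[RHS]E; apply: eq_bigr => i _; rewrite scalerBl.
  by rewrite divff // mulr1 subr_eq0 => /eqP->.
Qed.

(** * Elements close to 1 *)

Section Lattice.
Variables (F : fieldType) (s : F) (O : F -> Prop) (A : unitAlgType F) (L : A -> Prop).
Hypotheses (OV : is_valuation_ring s O) (LV : is_lattice O L).
Hypothesis A_div : forall x : A, x != 0 -> x \is a GRing.unit.

Let s0 : s != 0. Proof. exact: val_s_neq0 OV. Qed.
Let OM := valM OV.
Let Os := val_s OV.
Let OX x n : O x -> O (x ^+ n).
Proof. by move=> Ox; elim: n => [|n IHn]; [exact: val1 OV|rewrite exprS; apply: OM]. Qed.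

Lemma lat0 : L 0.
Proof.
have [c _ cP] := lat_primitive LV (oner_neq0 A).
by rewrite -(subrr (1 *: (c *: 1))); apply: (latB LV); apply/cP; apply: val1 OV.
Qed.
Lemma latN x : L x -> L (- x).
Proof. by move=> Lx; rewrite -sub0r; apply: (latB LV) => //; apply: lat0. Qed.
Lemma latD x y : L x -> L y -> L (x + y).
Proof. by move=> Lx Ly; rewrite -[y]opprK; apply: (latB LV) => //; apply: latN. Qed.

Lemma lat_absorb x : exists2 e, e != 0 & O e /\ L (e *: x).
Proof.
have [->|x0] := eqVneq x 0.
  by exists 1; rewrite ?oner_neq0 // scaler0; split; [apply: val1 OV|apply: lat0].
have [c c0 cP] := lat_primitive LV x0.
have Lcx : L (c *: x) by rewrite -[c *: x]scale1r; apply/cP; apply: val1 OV.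
have [Oc|Oc] := val_tot OV c; first by exists c.
exists 1; rewrite ?oner_neq0 // scale1r; split; first exact: val1 OV.
by rewrite -[x](scalerK c0); apply: (latZ LV).
Qed.

Lemma lat_le d e x : d != 0 -> O (e / d) -> L (d *: x) -> L (e *: x).
Proof. by move=> d0 Oed Ldx; rewrite -(divfK d0 e) -scalerA; apply: (latZ LV). Qed.

(** The hypotheses put [d^-1] in [s O] and [x] in [d^-1 L]. Without completeness there is no
    geometric series; instead the error [y] satisfies [y = - x - x * y]. For a primitive multiple
    [c y], either [c] is in [O] and this identity forces [d] into [O], which is absurd, or [c^-1] is
    in [O] and it bounds [y]. *)
Lemma near_inv d x : d != 0 -> O (s^-1 / d) -> L (d *: x) ->
  1 + x != 0 /\ L (d *: ((1 + x)^-1 - 1)).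
Proof.
move=> d0 Osd Ldx.
have nOd : ~ O d by move=> Od; apply: (val_sV OV); rewrite -(divfK d0 s^-1); apply: OM.
have x1 : 1 + x != 0.
  apply/eqP => /eqP; rewrite addrC addr_eq0 => /eqP xE; apply: nOd.
  have [c c0 cP] := lat_primitive LV (oner_neq0 A); apply/cP.
  have Lc : L (c *: 1) by rewrite -[c *: 1]scale1r; apply/cP; apply: val1 OV.
  have := latM LV (latN Ldx) Lc.
  by rewrite xE scalerN opprK -scalerAl mul1r.
split=> //; set y := _ - 1.
have yE : y = - x - x * y.
  have E : (1 + x)^-1 + x * (1 + x)^-1 = 1 by rewrite -{1}[_^-1]mul1r -mulrDl mulrV // A_div.
  by rewrite /y mulrBr mulr1 opprB addKr -[X in _ - X]E opprD addrA subrr sub0r.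
have [->|y0] := eqVneq y 0; first by rewrite scaler0; apply: lat0.
have [c c0 cP] := lat_primitive LV y0.
have Lcy : L (c *: y) by rewrite -[c *: y]scale1r; apply/cP; apply: val1 OV.
have Lxy : L ((d * c) *: (x * y)).
  by have := latM LV Ldx Lcy; rewrite -scalerAl -scalerAr scalerA.
have [Oc|Oc] := val_tot OV c.
  case: nOd; apply/cP; rewrite scalerA yE scalerDr !scalerN; apply: (latB LV) => //.
  by rewrite mulrC -scalerA; apply: latN; apply: (latZ LV).
rewrite yE scalerDr !scalerN; apply: (latB LV); first exact: latN.
by apply: lat_le Lxy; rewrite ?mulf_neq0 // invfM mulrA divff // mul1r.
Qed.

Lemma near_expr z n : L (s ^- 2 *: (z - 1)) -> L (s ^- 2 *: (z ^+ n - 1)).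
Proof.
move=> Lz; have Lz1 : L (z - 1).
  rewrite -[z - 1](scalerKV (expf_neq0 2 s0)); apply: (latZ LV) => //; exact: OX.
elim: n => [|n IHn]; first by rewrite subrr scaler0; apply: lat0.
have -> : z ^+ n.+1 - 1 = (z - 1) * (z ^+ n - 1) + ((z - 1) + (z ^+ n - 1)).
  by rewrite mulrBr mulr1 mulrBl -exprS mul1r addrA subrK addrA subrK.
have Lzn : L (z ^+ n - 1).
  rewrite -[_ - 1](scalerKV (expf_neq0 2 s0)); apply: (latZ LV) => //; exact: OX.
rewrite scalerDr [in X in _ + X]scalerDr; apply: latD; last exact: latD.
by rewrite scalerAl; apply: (latM LV).
Qed.

(** Let [v] be the additive commutator of [z] and [x], and [c v] primitive. Since [z] is 1 modulo
    [s ^+ 2 L], the commutator of [z ^+ n] and [x], scaled by [c], is [n c v] modulo [s ^+ 2 L]. If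
    it vanishes for [n = q], then [q] is in [s ^+ 2 O]. *)
Lemma near_root_step z x q : L (s ^- 2 *: (z - 1)) -> ~ O (s ^- 2 * q%:R) ->
  z ^+ q * x = x * z ^+ q -> z * x = x * z.
Proof.
move=> Lz nOq zqx; apply/eqP; rewrite -subr_eq0; apply/negP => /negP v0.
set v := z * x - x * z in v0.
have [c c0 cP] := lat_primitive LV v0.
have Lcv : L (c *: v) by rewrite -[c *: v]scale1r; apply/cP; apply: val1 OV.
have unscale y : L (s ^- 2 *: y) -> L y.
  move=> Ly; rewrite -[y](scalerKV (expf_neq0 2 s0)); apply: (latZ LV) => //; exact: OX.
pose E n := c *: (z ^+ n * x - x * z ^+ n).
suff EP n : L (s ^- 2 *: (E n - n%:R *: (c *: v))).
  apply: nOq; apply/cP; have := EP q.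
  by rewrite /E zqx subrr scaler0 sub0r scalerN => /latN; rewrite opprK !scalerA mulrA.
elim: n => [|n IHn].
  by rewrite /E !expr0 mulr1 mul1r subrr scaler0 scale0r subr0 scaler0; apply: lat0.
have LE : L (E n).
  rewrite -[E n](subrK (n%:R *: (c *: v))); apply: latD; first exact: unscale.
  by apply: (latZ LV) => //; apply: val_nat OV n.
have -> : E n.+1 - n.+1%:R *: (c *: v) =
    (E n - n%:R *: (c *: v)) + ((z - 1) * E n + (c *: v) * (z ^+ n - 1)).
  have -> : E n.+1 = z * E n + (c *: v) * z ^+ n.
    rewrite /E -scalerAr -scalerAl -scalerDr; congr (_ *: _).
    by rewrite /v mulrBr mulrBl !mulrA -exprS -[x * z * _]mulrA -exprS addrA subrK.
  rewrite mulrBl mulrBr mulr1 mul1r -natr1 scalerDl scale1r.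
  by rewrite opprD addrACA [in RHS]addrA [X in _ = X + _]addrC [X in _ = X + _]addrA subrK.
rewrite scalerDr [in X in _ + X]scalerDr; apply: latD => //; apply: latD.
  by rewrite scalerAl; apply: (latM LV).
by rewrite scalerAr; apply: (latM LV) => //; apply: near_expr.
Qed.

(** The prime factors of [n] are removed one at a time; each is nonzero in [F] because [n] is. *)
Lemma near_root z x n : (forall q, prime q -> q%:R != 0 :> F -> ~ O (s ^- 2 * q%:R)) ->
  L (s ^- 2 *: (z - 1)) -> n%:R != 0 :> F -> z ^+ n * x = x * z ^+ n -> z * x = x * z.
Proof.
move=> sP Lz; elim/ltn_ind: n => n IHn n0 zn.
have [n1|n1] := leqP n 1.
  by case: n n1 n0 zn {IHn} => [|[|//]] _; rewrite ?eqxx // expr1.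
have qp := pdiv_prime n1; have /dvdnP [m nE] := pdiv_dvd n.
move: n0; rewrite nE natrM mulf_eq0 negb_or => /andP[m0 q0].
have m_gt0 : (0 < m)%N by case: (m) m0; rewrite ?eqxx.
apply: (IHn m) => //; first by rewrite nE ltn_Pmulr // prime_gt1.
apply: (near_root_step (near_expr m Lz) (sP _ qp q0)).
by rewrite -exprM -nE.
Qed.

(* [X] contains elements [1 + t (B + o(1))] with [t -> 0]; smallness is measured by
   membership in [L] after multiplication by large scalars [c]. *)
Definition approximable (X : A -> Prop) (B : A) : Prop :=
  forall c, c != 0 -> exists t u,
    [/\ t != 0, O (c * t), X u & L (c *: (t^-1 *: (u - 1) - B))].

(** An element that is good for [c = 1] serves every [c] in [O]. *)
Lemma approximable_large (X : A -> Prop) B :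
  (forall c, c != 0 -> O c^-1 -> exists t u,
    [/\ t != 0, O (c * t), X u & L (c *: (t^-1 *: (u - 1) - B))]) ->
  approximable X B.
Proof.
move=> XB c c0; have [Oc|Oc] := val_tot OV c; last exact: XB.
have [|t [u [t0 Ot Xu Lu]]] := XB 1 (oner_neq0 _); first by rewrite invr1; apply: val1 OV.
exists t, u; split=> //; first by move: Ot; rewrite mul1r; apply: OM.
by move: Lu; rewrite scale1r; apply: (latZ LV).
Qed.

Lemma approximable_unit (X : A -> Prop) B :
  (forall u, u \is a GRing.unit -> X u) -> approximable X B.
Proof.
move=> XU; apply: approximable_large => c c0 Oc.
have [e e0 [Oe LeB]] := lat_absorb B.
(* The factor [e / c] brings [t B] into [s L], so that [1 + t B] is a unit by [near_inv] with
   [d = s^-1]. *)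
pose t := s * e / c.
have t0 : t != 0 by rewrite !mulf_neq0 ?invr_eq0.
exists t, (1 + t *: B); split=> //.
- by rewrite mulrC divfK //; apply: OM.
- apply/XU/A_div; have [||| //] := @near_inv s^-1 (t *: B); first by rewrite invr_eq0.
    by rewrite divff ?invr_eq0 //; apply: val1 OV.
  rewrite scalerA /t -mulrA mulKf // mulrC -scalerA; exact: (latZ LV).
- by rewrite [1 + _]addrC addrK scalerK // subrr scaler0; apply: lat0.
Qed.

(** For [u = 1 + t (B + eps)] and [W] the additive commutator of [a] and [B + eps], the group
    commutator is exactly [1 + t a^-1 u^-1 W]. Replacing [u^-1] by 1 and dropping [eps] leaves
    [B - a^-1 B a] as the coefficient of [t]. *)
Lemma approximable_commutator (X Y : A -> Prop) a B :
  a \is a GRing.unit -> (forall u, X u -> u \is a GRing.unit) ->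
  (forall u, X u -> Y (a^-1 * u^-1 * a * u)) ->
  approximable X B -> approximable Y (B - a^-1 * B * a).
Proof.
move=> aU XU XY XB; apply: approximable_large => c c0 Oc.
have [e e0 [Oe [Lea [LeaV LeB]]]] : exists2 e, e != 0 &
    O e /\ L (e *: a) /\ L (e *: a^-1) /\ L (e *: B).
  have [e1 e10 [Oe1 L1]] := lat_absorb a.
  have [e2 e20 [Oe2 L2]] := lat_absorb a^-1.
  have [e3 e30 [Oe3 L3]] := lat_absorb B.
  exists (e1 * e2 * e3); first by rewrite !mulf_neq0.
  split; first by apply: OM => //; apply: OM.
  split; [|split].
  - apply: lat_le L1 => //; have -> : e1 * e2 * e3 / e1 = e2 * e3 by field; rewrite e10.
    exact: OM.
  - by apply: lat_le L2 => //; rewrite mulrAC mulfK //; apply: OM.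
  - by apply: lat_le L3 => //; rewrite mulfK //; apply: OM.
(* The reserve of precision is dictated by the error [a^-1 * mu * W]: it costs one [e] for [a^-1],
   one for [mu] and two for [W]. *)
pose c1 := c / (e ^+ 4 * s).
have c10 : c1 != 0 by rewrite mulf_neq0 // invr_eq0 mulf_neq0 // expf_neq0.
have Oc1 : O c1^-1 by rewrite invf_div; apply: OM => //; apply: OM => //; apply: OX.
have [t [u [t0 Oct Xu]]] := XB c1 c10; set eps := _ - B => Leps.
have Ot : O t by rewrite -[t](mulKf c10); apply: OM.
have uE : u = 1 + t *: (B + eps).
  by rewrite /eps [B + _]addrC subrK scalerKV // addrC subrK.
clearbody eps.
have c1e0 : c1 * e != 0 by rewrite mulf_neq0.
have [|| _] := @near_inv (c1 * e) (t *: (B + eps)) c1e0.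
- have -> : s^-1 / (c1 * e) = c^-1 * e ^+ 3.
    by rewrite /c1; field; rewrite e0 c0 s0.
  by apply: OM => //; apply: OX.
- rewrite !scalerDr; apply: latD.
    have -> : (c1 * e) *: (t *: B) = (c1 * t) *: (e *: B) by rewrite !scalerA mulrAC.
    exact: (latZ LV).
  have -> : (c1 * e) *: (t *: eps) = (e * t) *: (c1 *: eps).
    by rewrite !scalerA; congr (_ *: _); ring.
  by apply: (latZ LV) => //; apply: OM.
rewrite -uE; set mu := u^-1 - 1 => Lmu.
exists t, (a^-1 * u^-1 * a * u); split=> //.
- have -> : c * t = (e ^+ 4 * s) * (c1 * t) by rewrite /c1; field; rewrite e0 s0.
  by apply: OM => //; apply: OM => //; apply: OX.
- exact: XY.
have [W WE] : exists W, W = a * (B + eps) - (B + eps) * a by eexists.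
have -> : t^-1 *: (a^-1 * u^-1 * a * u - 1) - (B - a^-1 * B * a) =
    (eps - a^-1 * eps * a) + a^-1 * mu * W.
  have -> : a^-1 * u^-1 * a * u - 1 = t *: (a^-1 * u^-1 * W).
    have uU := XU _ Xu.
    have -> : 1 = a^-1 * u^-1 * (u * a) by rewrite mulrA mulrVK // mulVr.
    rewrite -[_ * a * u]mulrA -mulrBr scalerAr; congr (_ * _).
    rewrite {1 2}uE mulrDr mulrDl mul1r mulr1 opprD addrACA subrr add0r.
    by rewrite WE -scalerAl -scalerAr -scalerBr.
  rewrite scalerK // -[u^-1](subrK 1) -/mu mulrDr mulr1 mulrDl addrC [a^-1 * mu * _ + _]addrC addrA.
  congr (_ + _); rewrite WE mulrBr mulKr // mulrA mulrDr mulrDl !opprD opprK.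
  by rewrite addrACA addKr addNKr.
have LB' : L (e *: (B + eps)).
  rewrite scalerDr; apply: latD => //.
  by apply: lat_le Leps => //; apply: OM.
rewrite !scalerDr scalerN; apply: latD; first apply: (latB LV).
- apply: lat_le Leps => //.
  have -> : c / c1 = e ^+ 4 * s by rewrite /c1; field; rewrite e0 c0 s0.
  by apply: OM => //; apply: OX.
- have -> : c *: (a^-1 * eps * a) = (s * e ^+ 2) *: ((e *: a^-1) * (c1 *: eps) * (e *: a)).
    rewrite -!(scalerAl, scalerAr) !scalerA; congr (_ *: _).
    by rewrite /c1; field; rewrite e0 s0.
  apply: (latZ LV); first by apply: OM => //; apply: OX.
  by apply: (latM LV) => //; apply: (latM LV).
- have -> : c *: (a^-1 * mu * W) = s *: ((e *: a^-1) * ((c1 * e) *: mu) * ((e * e) *: W)).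
    rewrite -!(scalerAl, scalerAr) !scalerA; congr (_ *: _).
    by rewrite /c1; field; rewrite e0 s0.
  apply: (latZ LV) => //; apply: (latM LV); first exact: (latM LV).
  have -> : (e * e) *: W = (e *: a) * (e *: (B + eps)) - (e *: (B + eps)) * (e *: a).
    by rewrite -!(scalerAl, scalerAr) !scalerA -scalerBr WE.
  by apply: (latB LV); apply: (latM LV).
Qed.

(** Take a sequence [1 + tau_n (B + eps_n)] in [X] with [tau_n] decreasing rapidly. For [j < k] the
    quotient of terms [j] and [k] is [1 - tau_j B] up to smaller terms, so [B] is kept and the sign
    goes into the scalar [- tau j]. *)
Lemma approximable_finite_index (X Y : A -> Prop) B :
  (forall u, X u -> u \is a GRing.unit) ->
  (forall f : nat -> A, (forall i, X (f i)) ->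
    exists j k, (j < k)%N /\ Y ((f j)^-1 * f k)) ->
  approximable X B -> approximable Y B.
Proof.
move=> XU XY XB; apply: approximable_large => c c0 Oc.
have [e e0 [Oe LeB]] := lat_absorb B.
pose c1 := c / (e ^+ 2 * s).
have c10 : c1 != 0 by rewrite mulf_neq0 // invr_eq0 mulf_neq0 // expf_neq0.
have Oc1 : O c1^-1 by rewrite invf_div; apply: OM => //; apply: OM => //; apply: OX.
(* At [d = 0] nothing is required, and the pair is a placeholder. *)
have /choice [T TP] : forall d, exists tu, d != 0 ->
    [/\ tu.1 != 0, O (d * tu.1), X tu.2 & L (d *: (tu.1^-1 *: (tu.2 - 1) - B))].
  move=> d; have [->|/XB [t [u tuP]]] := eqVneq d 0; first by exists (0, 0).
  by exists (t, u).
(* [g n] is the precision requested for term [n]. Asking for [c1 / tau_n] next makes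
   [c1 * tau_(n+1) / tau_n] lie in [O]. *)
pose g := fix g n := if n is m.+1 then c1 / (T (g m)).1 else c1.
have g0 n : g n != 0.
  elim: n => [|n IHn] //=; rewrite mulf_neq0 // invr_eq0.
  by have [] := TP _ IHn.
have [tau tauE] : exists tau, tau = fun n => (T (g n)).1 by exists (fun n => (T (g n)).1).
have [f fE] : exists f, f = fun n => (T (g n)).2 by exists (fun n => (T (g n)).2).
have gS n : g n.+1 = c1 / tau n by rewrite tauE.
have [tau0 Otau Xf] : [/\ forall n, tau n != 0, forall n, O (g n * tau n) & forall n, X (f n)].
  by split=> n; rewrite ?tauE ?fE; have [] := TP _ (g0 n).
have Lf n : L (g n *: ((tau n)^-1 *: (f n - 1) - B)).
  by rewrite tauE fE; have [] := TP _ (g0 n).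
have gP n : O (c1 / g n) /\ O (tau n).
  elim: n => [|n [_ IHn]].
    split; first by rewrite /= divff //; apply: val1 OV.
    by rewrite -[tau 0%N](mulKf c10); apply: OM => //; apply: (Otau 0%N).
  have Og : O (c1 / g n.+1) by rewrite gS invf_div mulrC divfK.
  split=> //; have -> : tau n.+1 = c1^-1 * (c1 / g n.+1) * (g n.+1 * tau n.+1).
    by field; rewrite c10 g0.
  by apply: OM => //; apply: OM.
have tauP j k : (j < k)%N -> O (c1 * (tau k / tau j)).
  elim: k => // k IHk; rewrite ltnS leq_eqVlt => /orP[/eqP->|/IHk O1].
    by have := Otau k.+1; rewrite gS mulrAC -mulrA.
  have -> : c1 * (tau k.+1 / tau j) = (g k.+1 * tau k.+1) * c1^-1 * (c1 * (tau k / tau j)).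
    by rewrite gS; field; rewrite c10 !tau0.
  by apply: OM => //; apply: OM.
have {XY} [j [k [jk Yjk]]] := XY f Xf.
have [eps epsP] : exists eps, forall n, eps n = (tau n)^-1 *: (f n - 1) - B.
  by exists (fun n => (tau n)^-1 *: (f n - 1) - B).
have fepsE n : f n = 1 + tau n *: (B + eps n).
  by rewrite epsP [B + _]addrC subrK scalerKV // addrC subrK.
have Leps n : L (c1 *: eps n) by rewrite epsP; apply: lat_le (Lf n) => //; case: (gP n).
have LB' n : L (e *: (B + eps n)).
  rewrite scalerDr; apply: latD => //.
  by apply: lat_le (Leps n) => //; apply: OM.
have c1e0 : c1 * e != 0 by rewrite mulf_neq0.
have [|| _] := @near_inv (c1 * e) (tau j *: (B + eps j)) c1e0.
- have -> : s^-1 / (c1 * e) = c^-1 * e.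
    by rewrite /c1; field; rewrite e0 c0 s0.
  exact: OM.
- rewrite !scalerDr; apply: latD.
    have -> : (c1 * e) *: (tau j *: B) = ((c1 / g j) * (g j * tau j)) *: (e *: B).
      by rewrite !scalerA; congr (_ *: _); field; rewrite g0.
    by apply: (latZ LV) => //; apply: OM => //; case: (gP j).
  have -> : (c1 * e) *: (tau j *: eps j) = (e * tau j) *: (c1 *: eps j).
    by rewrite !scalerA; congr (_ *: _); ring.
  by apply: (latZ LV) => //; apply: OM => //; case: (gP j).
rewrite -fepsE; set mu := (f j)^-1 - 1 => Lmu.
have Lmu1 : L mu.
  rewrite -[mu](scalerK c1e0); apply: (latZ LV) => //.
  have -> : (c1 * e)^-1 = c^-1 * (e * s) by rewrite /c1; field; rewrite e0 c0 s0.
  by apply: OM => //; apply: OM.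
exists (- tau j), ((f j)^-1 * f k); split=> //; first by rewrite oppr_eq0.
- have -> : c * - tau j = - (((e ^+ 2 * s) * (c1 / g j)) * (g j * tau j)).
    by rewrite /c1; field; rewrite e0 s0 g0.
  apply: (valN OV); apply: OM => //; apply: OM; last by case: (gP j).
  by apply: OM => //; apply: OX.
have -> : (- tau j)^-1 *: ((f j)^-1 * f k - 1) - B =
    eps j + mu * (B + eps j) - (tau k / tau j) *: ((1 + mu) * (B + eps k)).
  have -> : (f j)^-1 * f k - 1 = (1 + mu) * (tau k *: (B + eps k) - tau j *: (B + eps j)).
    rewrite /mu [1 + _]addrC subrK.
    have -> : tau k *: (B + eps k) - tau j *: (B + eps j) = f k - f j.
      by rewrite !fepsE opprD addrACA subrr add0r.
    by rewrite mulrBr mulVr //; apply: XU.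
  rewrite mulrBr scalerBr invrN !scaleNr opprK -!scalerAr !scalerA mulVf // scale1r.
  rewrite [_^-1 * _]mulrC [- _ + _]addrC addrAC; congr (_ - _).
  by rewrite mulrDl mul1r addrAC [B + _]addrC addrK.
rewrite scalerDr scalerN scalerDr; apply: (latB LV); first apply: latD.
- apply: lat_le (Leps j) => //.
  have -> : c / c1 = e ^+ 2 * s by rewrite /c1; field; rewrite e0 c0 s0.
  by apply: OM => //; apply: OX.
- have -> : c *: (mu * (B + eps j)) = s *: (((c1 * e) *: mu) * (e *: (B + eps j))).
    rewrite -!(scalerAl, scalerAr) !scalerA; congr (_ *: _).
    by rewrite /c1; field; rewrite e0 s0.
  by apply: (latZ LV) => //; apply: (latM LV).
- have -> : c *: ((tau k / tau j) *: ((1 + mu) * (B + eps k))) =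
      ((c1 * (tau k / tau j)) * (e * s)) *: ((1 + mu) * (e *: (B + eps k))).
    rewrite -!(scalerAl, scalerAr) !scalerA; congr (_ *: _).
    by rewrite /c1; field; rewrite e0 s0 tau0.
  apply: (latZ LV); first by apply: OM; [apply: tauP|apply: OM].
  by rewrite mulrDl mul1r; apply: latD => //; apply: (latM LV).
Qed.

End Lattice.

(** * Torsion in prime characteristic *)

Definition torsion (D : unitRingType) (x : D) : Prop := exists2 n, (0 < n)%N & x ^+ n = 1.

Lemma pigeonhole (T : eqType) (r : seq T) (f : nat -> T) :
  (forall n, f n \in r) -> exists i j, (i < j)%N /\ f i = f j.
Proof.
move=> fr; apply: contrapT => nE.
have /uniq_leq_size : uniq [seq f n | n <- iota 0 (size r).+1].
  rewrite map_inj_in_uniq ?iota_uniq // => i j _ _ E; apply/eqP.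
  by case: (ltngtP i j) => // ij; case: nE; [exists i, j|exists j, i].
move=> /(_ r); rewrite size_map size_iota ltnn => K.
by apply/negP: isT; rewrite -K => // _ /mapP [n _ ->].
Qed.

Lemma finite_powers_torsion (D : unitRingType) (r : seq D) (x : D) :
  x \is a GRing.unit -> (forall n, x ^+ n \in r) -> torsion x.
Proof.
move=> xU /pigeonhole [i [j [ij E]]]; exists (j - i)%N; first by rewrite subn_gt0.
by apply: (mulrI (unitrX i xU)); rewrite -exprD subnKC ?mulr1 // ltnW.
Qed.

Section PrimeChar.
Variables (D : unitRingType) (p : nat) (pD : p \in [pchar D]).

(** In characteristic [p] this is the span over the prime field: natural coefficients already give
    negatives, and only their residues matter, so the set is finite. *)
Definition nspan (I : finType) (l : I -> D) (x : D) : Prop :=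
  exists c : I -> nat, x = \sum_i l i *+ c i.

Section Nspan.
Variables (I : finType) (l : I -> D).

Lemma nspan_finite : exists r : seq D, forall x, nspan l x -> x \in r.
Proof.
have p_gt0 : (0 < p)%N by apply: prime_gt0; apply: pcharf_prime pD.
exists [seq \sum_i l i *+ (f : {ffun I -> 'I_p}) i | f <- enum {: {ffun I -> 'I_p}}] => _ [c ->].
apply/mapP; exists [ffun i => Ordinal (ltn_pmod (c i) p_gt0)]; first by rewrite mem_enum.
apply: eq_bigr => i _; rewrite ffunE /= {1}(divn_eq (c i) p) mulrnDr mulnC mulrnA.
by rewrite -[l i *+ p]mulr_natr pcharf0 // mulr0 mul0rn add0r.
Qed.

Lemma nspan0 : nspan l 0.
Proof. by exists (fun=> 0%N); rewrite big1. Qed.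
Lemma nspanD x y : nspan l x -> nspan l y -> nspan l (x + y).
Proof.
move=> [c ->] [d ->]; exists (fun i => c i + d i)%N.
by rewrite -big_split; apply: eq_bigr => i _; rewrite mulrnDr.
Qed.
Lemma nspanMn x n : nspan l x -> nspan l (x *+ n).
Proof.
move=> [c ->]; exists (fun i => c i * n)%N.
by rewrite -sumrMnl; apply: eq_bigr => i _; rewrite mulrnA.
Qed.
Lemma nspanN x : nspan l x -> nspan l (- x).
Proof.
have p_gt0 : (0 < p)%N by apply: prime_gt0; apply: pcharf_prime pD.
move=> /(nspanMn p.-1); congr nspan; apply/eqP; rewrite -addr_eq0 -mulrSr prednK //.
by rewrite -mulr_natr pcharf0 // mulr0.
Qed.
Lemma nspan_sum J (r : seq J) (P : pred J) (E : J -> D) :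
  (forall i, P i -> nspan l (E i)) -> nspan l (\sum_(i <- r | P i) E i).
Proof. by move=> lE; elim/big_ind: _ => //; [apply: nspan0|apply: nspanD]. Qed.
Lemma nspan_gen i : nspan l (l i).
Proof.
exists (fun j => (j == i)%N); rewrite (bigD1 i) //= eqxx big1 ?addr0 // => j.
by move/negPf->.
Qed.
Lemma nspanM x y : (forall i j, nspan l (l i * l j)) ->
  nspan l x -> nspan l y -> nspan l (x * y).
Proof.
move=> lM [c ->] [d ->]; rewrite mulr_suml; apply: nspan_sum => i _.
rewrite mulr_sumr; apply: nspan_sum => j _.
by rewrite mulrnAl mulrnAr; do 2!apply: nspanMn.
Qed.
End Nspan.

(** The monic relation keeps all powers of [y] in the finite span of the first [n] of them, so two
    powers coincide. *)
Lemma integral_torsion (y : D) n (c : 'I_n -> nat) : y \is a GRing.unit ->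
  y ^+ n = \sum_(i < n) y ^+ i *+ c i -> torsion y.
Proof.
move=> yU yn; pose l (i : 'I_n) := y ^+ i.
have [r rP] := nspan_finite l.
have n_gt0 : (0 < n)%N.
  case: n c yn {l r rP} => // c; rewrite big_ord0 expr0 => /eqP.
  by rewrite oner_eq0.
apply: (finite_powers_torsion (r := r) yU) => m; apply: rP.
elim: m => [|m [d IHm]]; first exact: (nspan_gen l (Ordinal n_gt0)).
rewrite exprS IHm mulr_sumr; apply: nspan_sum => i _.
rewrite mulrnAr; apply: nspanMn; rewrite /l -exprS.
have := ltn_ord i; rewrite leq_eqVlt => /orP[/eqP->|iS]; first by rewrite yn; exists c.
exact: (nspan_gen l (Ordinal iS)).
Qed.

Local Notation ev := (fun x : D => horner_alg (x : pPrimeCharType pD)).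

Lemma root_torsion (y : D) (f : {poly 'F_p}) : y \is a GRing.unit ->
  f != 0 -> ev y f = 0 -> torsion y.
Proof.
move=> yU f0 yf; set n := (size f).-1.
have sz : size f = n.+1 by rewrite /n prednK ?size_poly_gt0.
have lc0 : f`_n != 0 by rewrite -lead_coefE lead_coef_eq0.
apply: (@integral_torsion y n (fun i => (- (f`_i / f`_n) : 'F_p) : nat)) => //.
have : ev y ((f`_n)^-1 *: f) = 0 by rewrite linearZ /= yf mulr0.
rewrite -[f in _ *: f]coefK poly_def sz big_ord_recr /= scalerDr scalerA mulVf // scale1r.
rewrite scaler_sumr rmorphD rmorphXn /= horner_algX rmorph_sum /= => /eqP.
rewrite addrC addr_eq0 => /eqP->; rewrite -sumrN; apply: eq_bigr => i _.
rewrite scalerA linearZ /= rmorphXn /= horner_algX mulr_algl -scaleNr mulrC.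
by rewrite -[RHS]mulr_natl.
Qed.

End PrimeChar.

(** * Finite subrings *)

Section FiniteSubring.
Variables (D : unitRingType) (r : seq D).
Hypothesis r_closed : GRing.divring_closed (fun x => x \in r).
Let S := seq_sub r.
HB.instance Definition _ := Finite.on S.
HB.instance Definition _ := SubType.on S.
HB.instance Definition _ := GRing.SubChoice_isSubUnitRing.Build D _ S r_closed.

(** Wedderburn's little theorem for the finite domain whose elements are listed in [r]. *)
Lemma finite_subring_commutes : (forall x : D, x != 0 -> x \is a GRing.unit) ->
  forall x y, x \in r -> y \in r -> x * y = y * x.
Proof.
move=> D_div x y xr yr.
have S_dom : GRing.integral_domain_axiom (S : finUnitRingType).
  move=> a b ab; have {}ab : ssval a * ssval b = 0 := congr1 (@ssval _ _) ab.
  have [a0|/D_div aU] := eqVneq (ssval a) 0; apply/orP; [left|right]; apply/eqP/val_inj => //.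
  by apply: (mulrI aU); rewrite [LHS]ab mulr0.
exact: (congr1 (@ssval _ _) (@finDomain_mulrC _ S_dom (SeqSub xr) (SeqSub yr))).
Qed.
End FiniteSubring.

Section PrimeCharCommutative.
Variables (D : unitRingType) (p : nat) (pD : p \in [pchar D]).
Hypothesis D_div : forall x : D, x != 0 -> x \is a GRing.unit.

(** The span is a finite ring, so inverses of its nonzero elements are powers of them and
    Wedderburn's theorem applies. *)
Lemma nspan_commutes (I : finType) (l : I -> D) :
  nspan l 1 -> (forall i j, nspan l (l i * l j)) ->
  forall x y, nspan l x -> nspan l y -> x * y = y * x.
Proof.
move=> l1 lM; have [r0 r0P] := nspan_finite pD l.
pose r := [seq x <- r0 | `[< nspan l x >]].
have rP x : (x \in r) = `[< nspan l x >].
  rewrite mem_filter; case: asboolP => //= lx; exact: r0P.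
have lX x n : nspan l x -> nspan l (x ^+ n).
  by move=> lx; elim: n => // n IHn; rewrite exprS; apply: nspanM.
have r_closed : GRing.divring_closed (fun x => x \in r).
  split=> [|x y|x y]; rewrite ![_ \in (fun _ => _)]rP; first exact/asboolP.
    move=> /asboolP lx /asboolP ly; apply/asboolP; apply: nspanD => //.
    exact: (nspanN pD).
  move=> /asboolP lx /asboolP ly; apply/asboolP; apply: nspanM => //.
  have [->|/D_div yU] := eqVneq y 0; first by rewrite invr0; apply: nspan0.
  have [[//|n] _ yn] : torsion y.
    by apply: (finite_powers_torsion (r := r)) => // n; rewrite rP; apply/asboolP/lX.
  suff -> : y^-1 = y ^+ n by apply: lX.
  by apply: (mulrI yU); rewrite mulrV // -exprS.
by move=> x y lx ly; apply: (finite_subring_commutes r_closed) => //; rewrite rP; apply/asboolP.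
Qed.

End PrimeCharCommutative.

Lemma torsion_monoid (F : fieldType) (cs : seq F) :
  (forall c : F, c != 0 -> torsion c) ->
  exists M : seq F, [/\ 1 \in M, (forall c d, c \in M -> d \in M -> c * d \in M) &
    forall c, c \in cs -> c != 0 -> c \in M].
Proof.
move=> tF; elim: cs => [|c cs [M [M1 MM Mcs]]].
  exists [:: 1]; split=> // [|c d]; first by rewrite inE.
  by rewrite !inE => /eqP-> /eqP->; rewrite mulr1.
have [c0|/tF [n n_gt0 cn]] := eqVneq c 0.
  exists M; split=> // d; rewrite inE => /orP[/eqP->|]; last exact: Mcs.
  by rewrite c0 eqxx.
pose N := [seq m * c ^+ e | m <- M, e <- iota 0 n].
have NP m e : m \in M -> m * c ^+ e \in N.
  move=> Mm; rewrite -(expr_mod e cn); apply/allpairsP; exists (m, e %% n)%N.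
  by rewrite mem_iota ltn_mod.
exists N; split=> [|_ _ /allpairsP [[m e] [Mm _ ->]] /allpairsP [[m' e'] [Mm' _ ->]]|d].
- by have := NP 1 0%N M1; rewrite expr0 mulr1.
- by rewrite /= mulrACA -exprD; apply: NP; apply: MM.
rewrite inE => /orP[/eqP->|csd] d0; first by have := NP 1 1%N M1; rewrite expr1 mul1r.
by have := NP d 0%N (Mcs _ csd d0); rewrite expr0 mulr1.
Qed.

(** The coordinates of [1], [x], [y] and the structure constants are finitely many torsion scalars
    or 0, so the nonzero ones lie in a finite monoid [M]. The additive span of the products of [M]
    with the basis is then a finite ring containing [x] and [y]. *)
Lemma findim_torsion_commutative (F : fieldType) (A : unitAlgType F) p :
  p \in [pchar A] -> (forall x : A, x != 0 -> x \is a GRing.unit) ->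
  (exists n (b : 'I_n -> A), forall x, exists c : 'I_n -> F, x = \sum_i c i *: b i) ->
  (forall c : F, c != 0 -> torsion c) -> forall x y : A, x * y = y * x.
Proof.
move=> pA A_div [n [b bS]] tF x y.
have /choice [co coE] := bS.
pose cs := [seq co 1 k | k <- enum 'I_n] ++ [seq co x k | k <- enum 'I_n] ++
  [seq co y k | k <- enum 'I_n] ++
  [seq co (b ijk.1.1 * b ijk.1.2) ijk.2 | ijk <- enum {: 'I_n * 'I_n * 'I_n}].
have [M [M1 MM Mcs]] := torsion_monoid cs tF.
pose l (mk : 'I_(size M) * 'I_n) := M`_mk.1 *: b mk.2.
have lP c k : c \in M -> nspan l (c *: b k).
  move=> Mc; have ic : (index c M < size M)%N by rewrite index_mem.
  by have := nspan_gen l (Ordinal ic, k); rewrite /l /= nth_index.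
have span_co m z : m \in M -> (forall k, co z k \in cs) -> nspan l (m *: z).
  move=> Mm zcs; rewrite [z in _ *: z]coE scaler_sumr; apply: nspan_sum => k _.
  rewrite scalerA; have [->|cz0] := eqVneq (co z k) 0.
    by rewrite mulr0 scale0r; apply: nspan0.
  by apply/lP/MM => //; apply: Mcs.
have lM i j : nspan l (l i * l j).
  rewrite /l -scalerAl -scalerAr scalerA; apply: span_co => [|k].
    by apply: MM; apply: mem_nth.
  rewrite !mem_cat; apply/orP; right; apply/orP; right; apply/orP; right.
  by apply/mapP; exists (i.2, j.2, k); rewrite ?mem_enum.
have lz z : (forall k, co z k \in cs) -> nspan l z.
  by move=> zcs; rewrite -[z]scale1r; apply: span_co.
by apply: (nspan_commutes pA A_div _ lM); apply: lz => k; rewrite !mem_cat map_f ?mem_enum ?orbT.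
Qed.

(** * Words in a shifted element *)

(* Subgroups below the unit group in an almost subnormal chain all of whose terms
   contain [a].  Of normality only closure under commutators with [a] is kept, and
   of finite index only the pigeonhole principle for sequences, which restricts to
   division subrings without a choice of coset representatives. *)
Inductive descends (D : unitRingType) (a : D) : (D -> Prop) -> Prop :=
| descends_units X : (forall u, u \is a GRing.unit -> X u) -> descends a X
| descends_commutator X Y : unit_subgroup X -> descends a X ->
    (forall u, X u -> Y (a^-1 * u^-1 * a * u)) -> descends a Y
| descends_finite_index X Y : unit_subgroup X -> descends a X ->
    (forall f : nat -> D, (forall i, X (f i)) ->
      exists j k, (j < k)%N /\ Y ((f j)^-1 * f k)) -> descends a Y.

Section ShiftWords.
Variables (D : unitRingType) (p : nat) (pD : p \in [pchar D]) (a x : D).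
Hypothesis D_div : forall y : D, y != 0 -> y \is a GRing.unit.
Hypotheses (aU : a \is a GRing.unit) (x_shift : a^-1 * x * a = x + 1).
Hypothesis x_free : ~ torsion x.

Let ev : {poly 'F_p} -> D := horner_alg (x : pPrimeCharType pD).
Let evM f g : ev (f * g) = ev f * ev g.
Proof. exact: (rmorphM (horner_alg (x : pPrimeCharType pD))). Qed.
Let evC f g : ev f * ev g = ev g * ev f. Proof. by rewrite -evM mulrC evM. Qed.
(** A unit that is algebraic over the prime field would be torsion, so [x] is transcendental. *)
Let ev_inj : injective ev.
Proof.
move=> f g fg; apply/eqP; rewrite -subr_eq0; apply/negP => /negP fg0.
have xU : x \is a GRing.unit.
  apply: D_div; apply/eqP => x0; move: x_shift; rewrite x0 mulr0 mul0r add0r => /eqP.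
  by rewrite eq_sym oner_eq0.
apply: x_free; apply: (@root_torsion _ _ pD x (f - g)) => //.
by rewrite /= rmorphB /= -/ev fg subrr.
Qed.
Let evU f : f != 0 -> ev f \is a GRing.unit.
Proof.
move=> f0; apply/D_div/eqP => ef; case/eqP: f0; apply: ev_inj.
by rewrite ef /ev rmorph0.
Qed.

(** Conjugation by [a] is a ring automorphism that fixes the prime field and adds 1 to [x]. *)
Lemma conj_horner_shift f : a^-1 * ev f * a = ev (f \Po ('X + 1)).
Proof.
have conjM y z : a^-1 * (y * z) * a = (a^-1 * y * a) * (a^-1 * z * a).
  by rewrite !mulrA mulrK.
have evA c : ev c%:P = (c : nat)%:R.
  by rewrite /ev horner_algC -[LHS]/(_%:R * 1) mulr1.
elim/poly_ind: f => [|f c IHf]; first by rewrite comp_poly0 /ev rmorph0 mulr0 mul0r.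
have evX : ev 'X = x by rewrite /ev horner_algX.
have evD g h : ev (g + h) = ev g + ev h by rewrite /ev rmorphD.
have ev1 : ev 1 = 1 by rewrite /ev rmorph1.
rewrite comp_polyD comp_polyM comp_polyX comp_polyC !evD !evM !evD evX ev1 -IHf.
rewrite mulrDr mulrDl conjM x_shift evA; congr (_ + _).
by rewrite -mulrA mulr_natl mulrnAr mulVr.
Qed.

Definition linear_product (E : 'F_p -> nat) : {poly 'F_p} :=
  \prod_(j : 'F_p) ('X - j%:P) ^+ E j.
Local Notation N := linear_product.

Lemma linear_product_neq0 E : N E != 0.
Proof. by apply/prodf_neq0 => j _; rewrite expf_neq0 // polyXsubC_eq0. Qed.

Lemma linear_product_shift E : N E \Po ('X + 1) = N (fun j => E (j + 1)%R).
Proof.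
rewrite /N rmorph_prod (reindex_inj (addIr 1)) /=; apply: eq_bigr => j _.
rewrite rmorphXn rmorphB /= comp_polyX comp_polyC rmorphD /= polyC1.
by rewrite opprD addrACA subrr addr0.
Qed.

Lemma linear_productD E G : N (fun j => E j + G j)%N = N E * N G.
Proof. by rewrite /N -big_split; apply: eq_bigr => j _; rewrite exprD. Qed.

Lemma linear_productX E n : N (fun j => E j * n)%N = N E ^+ n.
Proof. by rewrite /N -prodrXl; apply: eq_bigr => j _; rewrite exprM. Qed.

Lemma mup_linear_product E i : mup i (N E) = E i.
Proof.
rewrite /N (bigD1 i) //= mupMl ?mup_XsubCX ?eqxx //.
rewrite /root horner_prod; apply/prodf_neq0 => j ji.
by rewrite horner_exp expf_neq0 // hornerXsubC subr_eq0 eq_sym.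
Qed.

(* The exponent [E - G] of the quotient of two linear products is not constant. *)
Definition shift_variant (E G : 'F_p -> nat) : Prop :=
  exists j, (E j + G (j + 1)%R != E (j + 1)%R + G j)%N.

(* Writing [e = E - G], if [e j - e (j + 1)] were constant then, its sum over ['F_p]
   being 0, it would vanish. *)
Lemma shift_variant_diff E G : shift_variant E G ->
  shift_variant (fun j => E j + G (j + 1)%R)%N (fun j => G j + E (j + 1)%R)%N.
Proof.
move=> [j0 /eqP nE]; apply: contrapT => nv; apply: nE.
pose e j := (E j)%:Z - (G j)%:Z.
pose d j := e j - e (j + 1)%R.
have dS j : d j = d (j + 1)%R.
  have : ~~ (E j + G (j + 1)%R + (G (j + 1)%R + E (j + 1 + 1)%R) !=
     E (j + 1)%R + G (j + 1 + 1)%R + (G j + E (j + 1)%R))%N.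
    by apply/negP => H; apply: nv; exists j.
  rewrite negbK /d /e => /eqP; lia.
have d0 j : d j = d 0.
  have : forall n : nat, d n%:R = d 0.
    by elim=> [|n IHn]; rewrite ?mulr0n // -natr1 -dS.
  by rewrite -[j]natr_Zp.
have : \sum_(j : 'F_p) d j = 0.
  by rewrite sumrB [X in X - _](reindex_inj (addIr 1)) subrr.
under eq_bigr => j _ do rewrite d0.
rewrite sumr_const card_Fp ?(pcharf_prime pD) // => /eqP; rewrite Num.Theory.mulrn_eq0.
have p_gt0 := prime_gt0 (pcharf_prime pD).
rewrite (gtn_eqF p_gt0) /= => /eqP d00.
by have := d0 j0; rewrite d00 /d /e; lia.
Qed.

(** The pair [E], [G] encodes the integer exponent [E - G]. Starting from [x] itself, a commutator
    with [a] turns an exponent [e] into [e j - e (j + 1)], and a finite-index step multiplies it by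
    a positive integer; both keep it nonconstant. *)
Lemma word_in_descendant X : descends a X ->
  exists z E G, [/\ X z, z * ev (N G) = ev (N E) & shift_variant E G].
Proof.
elim=> [{}X XU|{}X Y [_ [XU _]] _ [z [E [G [Xz zE EG]]]] XY
       |{}X Y [X1 [XU [XM XV]]] _ [z [E [G [Xz zE EG]]]] XY].
- exists x, (fun j : 'F_p => nat_of_bool (j == 0)), (fun=> 0%N); split.
  + apply/XU/D_div/eqP => x0; move: x_shift; rewrite x0 mulr0 mul0r add0r => /eqP.
    by rewrite eq_sym oner_eq0.
  + have -> : N (fun=> 0%N) = 1 by rewrite /N big1.
    have -> : N (fun j => nat_of_bool (j == 0)) = 'X.
      rewrite /N (bigD1 0) //= ?eqxx ?expr1 subr0 big1 ?mulr1 // => j.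
      by move/negPf->.
    by rewrite /ev rmorph1 mulr1 horner_algX.
  + by exists 0; rewrite eqxx add0r oner_eq0.
- exists (a^-1 * z^-1 * a * z), (fun j => E j + G (j + 1)%R)%N, (fun j => G j + E (j + 1)%R)%N.
  split; [exact: XY| |exact: shift_variant_diff].
  pose z' := a^-1 * z * a; have z'U : z' \is a GRing.unit.
    by rewrite /z' unitrMl // unitrMr ?unitrV //; apply: XU.
  have z'E : z' * ev (N (fun j => G (j + 1)%R)) = ev (N (fun j => E (j + 1)%R)).
    by rewrite -!linear_product_shift -!conj_horner_shift /z' !mulrA mulrK // -zE !mulrA.
  have z'w : z' * (a^-1 * z^-1 * a * z) = z.
    by rewrite /z' !mulrA mulrK // mulrK ?XU // mulVr // mul1r.
  apply: (mulrI z'U); rewrite mulrA z'w !linear_productD !evM [X in _ = _ * X]evC !mulrA zE z'E.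
  exact: evC.
have [j [k [jk Yjk]]] : exists j k, (j < k)%N /\ Y ((z ^+ j)^-1 * z ^+ k).
  by apply: XY => i; elim: i => // i IHi; rewrite exprS; apply: XM.
have zU := XU _ Xz; have QU := evU (linear_product_neq0 G).
exists (z ^+ (k - j)), (fun i => E i * (k - j))%N, (fun i => G i * (k - j))%N; split.
- by rewrite -(subnKC (ltnW jk)) exprD mulKr ?unitrX // in Yjk.
- have zQ : GRing.comm z (ev (N G)).
    by apply: (mulIr QU); rewrite zE evC -zE mulrA.
  rewrite !linear_productX /ev !rmorphXn /= -/ev.
  by rewrite -[LHS]exprMn_comm // zE.
- case: EG => i EG; exists i; rewrite -!mulnDl eqn_mul2r negb_or EG andbT.
  by rewrite subn_eq0 -ltnNge.
Qed.

(** A power of the word commutes with [a], so the quotient of linear products that it equals is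
    invariant under the shift. Comparing multiplicities of roots then makes the exponent
    constant. *)
Lemma descendant_no_shift X : unit_subgroup X -> descends a X ->
  (forall z, X z -> exists2 n, (0 < n)%N & GRing.comm a ((a^-1 * z^-1 * a * z) ^+ n)) ->
  False.
Proof.
move=> XG aX Xn.
(* With [Y] the bare set of commutators, the word found in [Y] is one to which [Xn] applies. *)
pose Y y := exists2 z, X z & y = a^-1 * z^-1 * a * z.
have aY : descends a Y by apply: (descends_commutator XG aX) => u Xu; exists u.
have [w [E [G [[z Xz ->] wE [j EG]]]]] := word_in_descendant aY.
have [n n_gt0 wn] := Xn _ Xz; move: wE wn; set w' := _ * z => wE wn.
have QU := evU (linear_product_neq0 G).
have wQ : GRing.comm w' (ev (N G)) by apply: (mulIr QU); rewrite wE evC -wE mulrA.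
pose E' j := (E j * n)%N; pose G' j := (G j * n)%N.
have vE : w' ^+ n * ev (N G') = ev (N E').
  by rewrite !linear_productX /ev !rmorphXn /= -/ev -[LHS]exprMn_comm // wE.
have vE' : w' ^+ n * ev (N (fun j => G' (j + 1)%R)) = ev (N (fun j => E' (j + 1)%R)).
  rewrite -!linear_product_shift -!conj_horner_shift -vE !mulrA; congr (_ * _ * _).
  by apply: (mulrI aU); rewrite !mulrA wn mulrK // mulrV // mul1r.
have /ev_inj/(congr1 (mup j)) : ev (N (fun j => E' j + G' (j + 1)%R)%N) =
    ev (N (fun j => E' (j + 1)%R + G' j)%N).
  by rewrite !linear_productD !evM -vE -vE' -!mulrA evC.
rewrite !mup_linear_product /E' /G' -!mulnDl => /eqP; rewrite eqn_pmul2r //.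
by apply/negP.
Qed.

End ShiftWords.

(** * Elements with a shift *)

(** The first-order coefficient in [t] of the group commutator of [a] and [1 + t b]. *)
Definition conj_diff (D : unitRingType) (a b : D) : D := b - a^-1 * b * a.

Lemma conj_diff_eq0 (D : unitRingType) (a b : D) : a \is a GRing.unit ->
  (conj_diff a b == 0) = (a * b == b * a).
Proof.
move=> aU; rewrite subr_eq0; apply/eqP/eqP => [{1}->|E].
  by rewrite !mulrA mulrV // mul1r.
by rewrite -mulrA -E mulKr.
Qed.

(** Descend to a [b] that does not commute with [a] while [c = conj_diff a b] does. Then
    [a^-1 b a = b - c], and [- b / c] is shifted by 1. *)
Lemma nilpotent_conj_diff_shift (D : unitRingType) (a b : D) k :
  (forall y : D, y != 0 -> y \is a GRing.unit) -> a \is a GRing.unit ->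
  iter k (conj_diff a) b = 0 -> a * b != b * a ->
  exists x, a^-1 * x * a = x + 1.
Proof.
move=> D_div aU; elim: k b => [|k IHk] b; first by move=> /= ->; rewrite mulr0 mul0r eqxx.
rewrite iterSr => kb ab.
have [ac|/IHk] := eqVneq (a * conj_diff a b) (conj_diff a b * a); last exact.
have cU : conj_diff a b \is a GRing.unit by apply: D_div; rewrite conj_diff_eq0.
exists (- b / conj_diff a b); set c := conj_diff a b in ac cU *.
have acV : a * c^-1 = c^-1 * a.
  by apply: (mulrI cU); rewrite mulrA -ac mulrK // mulVKr.
rewrite mulrA -[_ * c^-1 * a]mulrA -acV mulrA; apply: (mulIr cU); rewrite mulrDl mul1r !mulrVK //.
by rewrite mulrN mulNr /c /conj_diff addrA addNr sub0r.
Qed.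

(** Left and right multiplication by [w] commute, so the Frobenius identity applies to their
    difference. They are modelled in [{poly D}]: [phi] turns coefficients into left multiplications
    of [b] and ['X] into right multiplication by [w]. *)
Lemma iter_commutator_pchar (D : unitRingType) p (w b : D) : p \in [pchar D] ->
  iter p (fun y => w * y - y * w) b = w ^+ p * b - b * w ^+ p.
Proof.
move=> pD; pose phi (f : {poly D}) := (map_poly (b \o* idfun) f).[w].
have phiB f g : phi (f - g) = phi f - phi g by rewrite /phi raddfB hornerD hornerN.
have phiC c f : phi (c%:P * f) = c * phi f.
  rewrite /phi; have -> : map_poly (b \o* idfun) (c%:P * f) = c%:P * map_poly (b \o* idfun) f.
    by apply/polyP => i; rewrite coefCM !coef_map coefCM /= mulrA.
  by rewrite hornerCM.
have phiX f : phi ('X * f) = phi f * w.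
  rewrite /phi -commr_polyX.
  have -> : map_poly (b \o* idfun) (f * 'X) = map_poly (b \o* idfun) f * 'X.
    apply/polyP => i; rewrite coefMX !coef_map coefMX /=.
    by case: eqP => _; rewrite ?mul0r // coef_map.
  by rewrite hornerMX.
have phi1 : phi 1 = b.
  by rewrite /phi map_polyC hornerC /= mul1r.
have iterE n : iter n (fun y => w * y - y * w) b = phi ((w%:P - 'X) ^+ n).
  elim: n => [|n IHn]; first by rewrite expr0 phi1.
  by rewrite iterS IHn exprS mulrBl phiB phiC phiX.
have pP : p \in [pchar {poly D}] by apply: (rmorph_pchar (@polyC D)).
have cX : GRing.comm (w%:P) ('X : {poly D}) by apply: commr_polyX.
rewrite iterE -(pFrobenius_autE pP) (pFrobenius_autB_comm pP cX) !pFrobenius_autE.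
rewrite -polyC_exp phiB -[_%:P]mulr1 phiC phi1; congr (_ - _).
elim: (p) => [|n IHn]; first by rewrite !expr0 phi1 mulr1.
by rewrite exprS phiX IHn exprSr mulrA.
Qed.

(** [conj_diff w] is [w^-1] times the additive commutator [ad] with [w], and these two factors
    commute. Its iterate of order [p] therefore vanishes with that of [ad]. *)
Lemma central_pchar_root_shift (D : unitRingType) p (w : D) : p \in [pchar D] ->
  (forall y : D, y != 0 -> y \is a GRing.unit) -> w \is a GRing.unit ->
  (forall y, w ^+ p * y = y * w ^+ p) -> (exists y, w * y != y * w) ->
  exists x, w^-1 * x * w = x + 1.
Proof.
move=> pD D_div wU wp [b wb].
apply: (@nilpotent_conj_diff_shift _ _ b p) => //.
pose ad y := w * y - y * w.
have adM y : ad (w^-1 * y) = w^-1 * ad y.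
  by rewrite /ad mulrBr mulVKr // mulKr // mulrA.
have E n : iter n (conj_diff w) b = w ^- n * iter n ad b.
  elim: n => [|n IHn]; first by rewrite expr0 invr1 mul1r.
  have diffE y : conj_diff w y = w^-1 * ad y.
    by rewrite /conj_diff /ad mulrBr mulKr // mulrA.
  rewrite !iterS IHn diffE exprSr invrM ?unitrX // -mulrA; congr (_ * _).
  elim: n {IHn} (iter n ad b) => [|n IHn] y; first by rewrite expr0 invr1 !mul1r.
  by rewrite exprSr invrM ?unitrX // -!mulrA adM IHn.
by rewrite E iter_commutator_pchar // wp subrr mulr0.
Qed.

(** If [x] is torsion, [x + s] replaces it. Were both torsion, their commuting powers would span a
    finite ring containing [s], and [s] would be torsion. *)
Lemma nontorsion_shift (F : fieldType) (A : unitAlgType F) p (s : F) (a x : A) :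
  p \in [pchar A] -> (forall y : A, y != 0 -> y \is a GRing.unit) ->
  a \is a GRing.unit -> s != 0 -> ~ torsion s ->
  a^-1 * x * a = x + 1 -> exists2 y, ~ torsion y & a^-1 * y * a = y + 1.
Proof.
move=> pA A_div aU s0 sT ax.
have [[m m_gt0 xm]|xT] := pselect (torsion x); last by exists x.
exists (x + s%:A); last first.
  by rewrite mulrDr mulrDl ax -scalerAr mulr1 -scalerAl mulVr // addrAC.
move=> [n n_gt0 yn]; apply: sT; set y := x + s%:A in yn.
have xy : GRing.comm x y.
  by apply: commrD => //; rewrite /GRing.comm -scalerAr -scalerAl mulr1 mul1r.
pose l (ij : 'I_m * 'I_n) := x ^+ ij.1 * y ^+ ij.2.
have lP i j : nspan l (x ^+ i * y ^+ j).
  rewrite -(expr_mod i xm) -(expr_mod j yn).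
  exact: (nspan_gen l (Ordinal (ltn_pmod i m_gt0), Ordinal (ltn_pmod j n_gt0))).
have lM i j : nspan l (l i * l j).
  rewrite /l mulrA -[_ * _ * x ^+ _]mulrA (commrX _ (commr_sym (commrX _ xy))).
  by rewrite mulrA -exprD -mulrA -exprD.
have ls : nspan l s%:A.
  have -> : s%:A = y - x by rewrite /y addrC addKr.
  apply: nspanD; first by have := lP 0%N 1%N; rewrite expr0 mul1r expr1.
  by apply: (nspanN pA); have := lP 1%N 0%N; rewrite expr0 mulr1 expr1.
have [r rP] := nspan_finite pA l.
have [|k|k k_gt0] := @finite_powers_torsion A r s%:A.
- by apply: A_div; rewrite scaler_eq0 (negPf s0) oner_eq0.
- apply: rP; elim: k => [|k IHk]; first by have := lP 0%N 0%N; rewrite expr0 mulr1.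
  by rewrite exprS; apply: nspanM.
rewrite exprZn expr1n => sk; exists k => //; apply/eqP; rewrite -subr_eq0.
have : (s ^+ k - 1) *: (1 : A) == 0 by rewrite scalerBl scale1r sk subrr.
by rewrite scaler_eq0 oner_eq0 orbF.
Qed.

Lemma annihilating_poly (F : fieldType) (A : algType F) (a : A) :
  (exists n (b : 'I_n -> A), forall x, exists c : 'I_n -> F, x = \sum_i c i *: b i) ->
  exists2 f : {poly F}, f != 0 & horner_alg a f = 0.
Proof.
move=> [n [b bS]]; have /choice [c cE] := fun i : 'I_n.+1 => bS (a ^+ i).
pose M := \matrix_(i < n.+1, j < n) c i j.
have : kermx M != 0.
  by rewrite -mxrank_eq0 mxrank_ker -lt0n subn_gt0 ltnS rank_leq_col.
case/rowV0Pn => v /sub_kermxP vM v0.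
exists (\poly_(i < n.+1) v 0 (inord i)).
  apply/eqP => f0; case/eqP: v0; apply/rowP => i; rewrite mxE.
  by have := congr1 (fun f : {poly F} => f`_i) f0; rewrite coef_poly ltn_ord inord_val coef0.
rewrite poly_def rmorph_sum /=.
transitivity (\sum_(i < n.+1) \sum_(j < n) (v 0 i * M i j) *: b j).
  apply: eq_bigr => i _; rewrite linearZ /= rmorphXn /= horner_algX mulr_algl inord_val.
  rewrite cE scaler_sumr; apply: eq_bigr => j _; by rewrite scalerA mxE.
rewrite exchange_big /= big1 // => j _; rewrite -scaler_suml.
have := congr1 (fun u : 'rV_n => u 0 j) vM; rewrite !mxE => ->.
by rewrite scale0r.
Qed.

(** With [b = - x / a] the commutator [a b - b a] is 1, so commutation with [b] differentiates
    polynomials in [a]. Derivatives of an annihilating polynomial annihilate too, down to a nonzero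
    constant. *)
Lemma pchar0_no_shift (F : fieldType) (A : unitAlgType F) (a x : A) :
  (forall n, (0 < n)%N -> n%:R != 0 :> F) ->
  (exists n (b : 'I_n -> A), forall x, exists c : 'I_n -> F, x = \sum_i c i *: b i) ->
  a \is a GRing.unit -> a^-1 * x * a = x + 1 -> False.
Proof.
move=> F0 bS aU ax; pose b := - (x / a).
have ab : a * b - b * a = 1.
  have xa : x * a = a * x + a by rewrite -[X in _ + X]mulr1 -mulrDr -ax -!mulrA mulVKr.
  rewrite /b mulrN mulNr opprK mulrVK // mulrA.
  have -> : a * x = x * a - a by rewrite xa addrK.
  by rewrite mulrBl mulrK // mulrV // opprB subrK.
pose ev := horner_alg a : {poly F} -> A.
have evD f : ev f * b - b * ev f = ev f^`().
  elim/poly_ind: f => [|f c IHf]; first by rewrite deriv0 /ev rmorph0 mul0r mulr0 subrr.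
  have evM g h : ev (g * h) = ev g * ev h by apply: (rmorphM (horner_alg a)).
  have evA g h : ev (g + h) = ev g + ev h by apply: (rmorphD (horner_alg a)).
  have evC d : ev d%:P = d%:A by apply: horner_algC.
  have evX : ev 'X = a by apply: horner_algX.
  rewrite derivD derivM derivX derivC addr0 mulr1 !evA !evM evX evC -IHf.
  rewrite mulrDl mulrDr -scalerAl -scalerAr mul1r mulr1 opprD addrACA subrr addr0.
  have abE : a * b = b * a + 1 by rewrite -ab addrC subrK.
  by rewrite -mulrA abE mulrDr mulr1 mulrBl !mulrA addrAC.
have [f f0 evf] := annihilating_poly a bS.
have [n le_n] := ubnP (size f); elim: n f f0 evf le_n => // n IHn f f0 evf le_n.
have [f'0|f'0] := eqVneq f^`() 0; last first.
  apply: (IHn _ f'0); first by rewrite -/ev -evD /ev evf mul0r mulr0 subrr.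
  exact: leq_trans (lt_size_deriv f0) le_n.
have fC : f = (f`_0)%:P.
  apply/polyP => -[|i]; rewrite coefC //=; apply/eqP.
  have /eqP := congr1 (fun g : {poly F} => g`_i) f'0.
  by rewrite coef_deriv coef0 -mulr_natr mulf_eq0 (negPf (F0 _ _)) // orbF.
move: evf f0; rewrite fC horner_algC => /eqP; rewrite scaler_eq0 oner_eq0 orbF.
by move=> /eqP ->; rewrite eqxx.
Qed.

(** * The finite-dimensional case *)

Definition central (D : unitRingType) (z : D) : Prop := forall y, z * y = y * z.

Section NearOne.
Variables (F : fieldType) (s : F) (O : F -> Prop) (A : unitAlgType F) (L : A -> Prop).
Hypotheses (OV : is_valuation_ring s O) (LV : is_lattice O L).
Hypothesis A_div : forall x : A, x != 0 -> x \is a GRing.unit.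
Let s0 : s != 0. Proof. exact: val_s_neq0 OV. Qed.

(** Extra precision forces the approximating elements into [1 + s ^+ 2 L], where roots of central
    elements can be taken. *)
Lemma approximable_near (X : A -> Prop) B : approximable O L X B ->
  approximable O L (fun u => X u /\ L (s ^- 2 *: (u - 1))) B.
Proof.
move=> XB; apply: (approximable_large OV LV) => c c0 Oc.
have [e e0 [Oe LeB]] := lat_absorb OV LV B.
pose c1 := c / (e * s ^+ 2).
have c10 : c1 != 0 by rewrite mulf_neq0 // invr_eq0 mulf_neq0 // expf_neq0.
have Os2 : O (s ^+ 2) by apply: (valM OV); apply: val_s OV.
have Oc1 : O c1^-1.
  by rewrite invf_div; apply: (valM OV) => //; apply: (valM OV).
have [t [u [t0 Oct Xu Lu]]] := XB c1 c10.
have [eps epsE] : exists eps, eps = t^-1 *: (u - 1) - B by eexists.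
rewrite -epsE in Lu.
have uE : u - 1 = t *: (B + eps) by rewrite epsE [B + _]addrC subrK scalerKV.
exists t, u; split=> //.
- have -> : c * t = e * s ^+ 2 * (c1 * t) by rewrite /c1; field; rewrite e0 s0.
  by do 2!apply: (valM OV) => //.
- split=> //; rewrite uE scalerDr scalerDr; apply: (latD OV LV).
    have -> : s ^- 2 *: (t *: B) = ((c1 * t) * c^-1) *: (e *: B).
      by rewrite !scalerA; congr (_ *: _); rewrite /c1; field; rewrite e0 s0 c0.
    by apply: (latZ LV) => //; apply: (valM OV).
  have -> : s ^- 2 *: (t *: eps) = (e * c^-1 * t) *: (c1 *: eps).
    by rewrite !scalerA; congr (_ *: _); rewrite /c1; field; rewrite e0 s0 c0.
  apply: (latZ LV) => //; apply: (valM OV); first exact: (valM OV).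
  by rewrite -[t](mulKf c10); apply: (valM OV).
- rewrite -epsE; apply: (lat_le LV c10 _ Lu).
  have -> : c / c1 = e * s ^+ 2 by rewrite /c1; field; rewrite e0 s0 c0.
  exact: (valM OV).
Qed.

(** If [u] is central, the commutator of [B] with [y] equals that of the error up to sign, hence is
    arbitrarily small. A nonzero one with primitive multiple by [c] would put [s^-1] in [O]. *)
Lemma approximable_central B :
  approximable O L (fun u => forall y, u * y = y * u) B -> forall y, B * y = y * B.
Proof.
move=> XB y; apply/eqP; rewrite -subr_eq0; apply/negP => /negP v0.
have [c c0 cP] := lat_primitive LV v0.
have [e e0 [Oe Ley]] := lat_absorb OV LV y.
have cse : c / (s * e) != 0 by rewrite mulf_neq0 // invr_eq0 mulf_neq0.
have [t [u [t0 _ uC Lu]]] := XB _ cse.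
have [eps epsE] : exists eps, eps = t^-1 *: (u - 1) - B by eexists.
rewrite -epsE in Lu; apply: (val_sV OV); apply/cP.
have BE : B = t^-1 *: (u - 1) - eps by rewrite epsE opprB addrC subrK.
have -> : s^-1 *: (c *: (B * y - y * B)) =
    (e *: y) * ((c / (s * e)) *: eps) - ((c / (s * e)) *: eps) * (e *: y).
  rewrite -!(scalerAl, scalerAr) !scalerA [e * _]mulrC -scalerBr; congr (_ *: _).
    by field; rewrite e0 s0.
  rewrite BE mulrBl mulrBr -!(scalerAl, scalerAr) mulrBl mulrBr mul1r mulr1 uC.
  by rewrite opprB addrC addrA subrK.
by apply: (latB LV); apply: (latM LV).
Qed.

Lemma approximable_descendant a X : a \is a GRing.unit -> descends a X ->
  exists k, forall B, approximable O L X (iter k (conj_diff a) B).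
Proof.
move=> aU; elim=> {X} [X XU|X Y [_ [XU _]] _ [k IHk] XY|X Y [_ [XU _]] _ [k IHk] XY].
- by exists 0%N => C; apply: (approximable_unit OV LV A_div).
- exists k.+1 => C; rewrite iterS; apply: (approximable_commutator OV LV A_div aU XU XY).
  exact: IHk.
- by exists k => C; apply: (approximable_finite_index OV LV A_div XU XY).
Qed.

Lemma near_root_central (z : A) n i :
  (forall q, prime q -> q%:R != 0 :> F -> ~ O (s ^- 2 * q%:R)) ->
  L (s ^- 2 *: (z - 1)) -> n%:R != 0 :> F ->
  central (z ^+ (i * n)) -> central (z ^+ i).
Proof.
move=> sP Lz n0 zin y; apply: (near_root OV LV sP (near_expr OV LV i Lz) n0).
by rewrite -exprM.
Qed.

(** The first hypothesis, the one on roots and the one on shifts isolate what depends on the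
    characteristic. *)
Lemma descendant_central (X : A -> Prop) :
  (forall q, prime q -> q%:R != 0 :> F -> ~ O (s ^- 2 * q%:R)) ->
  unit_subgroup X -> (forall a, X a -> descends a X) ->
  (forall a u, X a -> X u -> exists2 n, (0 < n)%N & central ((a^-1 * u^-1 * a * u) ^+ n)) ->
  (forall z n, X z -> (0 < n)%N -> central (z ^+ n) ->
    (forall i m, m%:R != 0 :> F -> central (z ^+ (i * m)) -> central (z ^+ i)) -> central z) ->
  (forall a x, X a -> a^-1 * x * a = x + 1 -> False) ->
  forall a, X a -> central a.
Proof.
move=> sP XG Xdesc Xtor Xroot Xshift a Xa.
have [X1 [XU [XM XV]]] := XG; have aU := XU _ Xa.
have [k kP] := approximable_descendant aU (Xdesc _ Xa).
move=> y; apply/eqP/negPn/negP => ay.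
have [x] : exists x, a^-1 * x * a = x + 1; last exact: Xshift.
(* [k] iterations come from the descent, one from a further commutator with [a], which has a central
   power, and one because the result is central. *)
apply: (@nilpotent_conj_diff_shift _ a y k.+2) => //.
rewrite iterS; apply/eqP; rewrite conj_diff_eq0 //; apply/eqP.
pose X2 z := exists2 u, X u & z = a^-1 * u^-1 * a * u.
have X2B : approximable O L X2 (iter k.+1 (conj_diff a) y).
  apply: (approximable_commutator OV LV A_div aU XU) (kP y) => u Xu; by exists u.
symmetry; apply: approximable_central => c c0.
have [t [z [t0 ct [[u Xu zE] Lz] Lc]]] := approximable_near X2B c0.
exists t, z; split=> //; have Xz : X z by rewrite zE; do 3?[apply: (XM)] => //; apply: (XV).
have [n n_gt0 zn] := Xtor a u Xa Xu; rewrite -zE in zn.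
by apply: (Xroot z n) => // i m; apply: near_root_central.
Qed.

End NearOne.

(** The part of [n] prime to [p] is removed by the last hypothesis. If a factor [p] could not be
    removed, a power of [z] would admit a shift. *)
Lemma charp_root_central (F : fieldType) (A : unitAlgType F) p (X : A -> Prop) :
  p \in [pchar F] -> (forall x : A, x != 0 -> x \is a GRing.unit) ->
  (forall z, X z -> z \is a GRing.unit) -> (forall z n, X z -> X (z ^+ n)) ->
  (forall a x, X a -> a^-1 * x * a = x + 1 -> False) ->
  forall z n, X z -> (0 < n)%N -> central (z ^+ n) ->
    (forall i m, m%:R != 0 :> F -> central (z ^+ (i * m)) -> central (z ^+ i)) -> central z.
Proof.
move=> pF A_div XU XX Xshift z n Xz n_gt0 zn zroot.
have pA : p \in [pchar A] by rewrite pchar_lalg.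
have p_pr := pcharf_prime pF.
have : central (z ^+ (p ^ logn p n)).
  apply: (zroot _ (n`_p^')%N); last by rewrite -p_part partnC.
  by rewrite -(dvdn_pcharf pF) -prime.p'natE // part_pnat.
elim: (logn p n) => [|e IHe]; first by rewrite expn0 expr1.
rewrite expnSr exprM => zpe; apply: IHe => y; apply/eqP/negPn/negP => zy.
have Xw := XX _ (p ^ e)%N Xz.
have [x] := central_pchar_root_shift pA A_div (XU _ Xw) zpe (ex_intro _ y zy).
exact: Xshift.
Qed.

(** Totality decides: [w / s] in [O] gives [s^-1 = w / s + b] in [O], and [s / w] in [O] gives
    [w^-1 = 1 + b s / w]. *)
Lemma valuation_unit (F : fieldType) (s : F) (O : F -> Prop) (b : F) :
  is_valuation_ring s O -> O b -> O (1 - s * b)^-1.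
Proof.
move=> OV Ob; have s0 := val_s_neq0 OV; set w := 1 - s * b.
have [w0|w0] := eqVneq w 0; first by rewrite w0 invr0; apply: val0 OV.
have [Ows|Osw] := val_tot OV (w / s).
  case: (val_sV OV); have -> : s^-1 = w / s + b by rewrite /w; field.
  exact: (valD OV).
have -> : w^-1 = 1 + b * (w / s)^-1.
  rewrite invf_div mulrA [b * s]mulrC; apply: (mulIf w0).
  by rewrite mulrDl mulVf // divfK // mul1r /w subrK.
by apply: (valD OV); [apply: val1 OV|apply: (valM OV)].
Qed.

Theorem findim_descendant_central (F : fieldType) (A : unitAlgType F) (X : A -> Prop) :
  (forall x : A, x != 0 -> x \is a GRing.unit) ->
  (exists n (b : 'I_n -> A), forall x, exists c : 'I_n -> F, x = \sum_i c i *: b i) ->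
  unit_subgroup X -> (forall a, X a -> descends a X) ->
  (forall a u, X a -> X u -> exists2 n, (0 < n)%N & central ((a^-1 * u^-1 * a * u) ^+ n)) ->
  forall a, X a -> central a.
Proof.
move=> A_div bS XG Xdesc Xtor; have [X1 [XU [XM XV]]] := XG.
have XX z n : X z -> X (z ^+ n).
  by move=> Xz; elim: n => // n IHn; rewrite exprS; apply: XM.
have [[p pF]|F0] := pselect (exists p, p \in [pchar F]); last first.
  have {}F0 n : (0 < n)%N -> n%:R != 0 :> F.
    move=> n_gt0; apply/negP => n0; apply: F0; have [p pF] := natf0_pchar n_gt0 n0.
    by exists p.
  have intr_inj (m : int) : m%:~R = 0 :> F -> m = 0.
    case: m => [[|n]|n] //; first by move/eqP; rewrite (negPf (F0 _ _)).
    by move/eqP; rewrite NegzE mulrNz oppr_eq0 (negPf (F0 _ _)).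
  have s0 : 2%:R != 0 :> F by apply: F0.
  have [f|O OV] := @valuation_ring_exists F 2%:R s0.
    apply/eqP => fE; have := congr1 (fun y => y * 2%:R - 1) fE.
    have -> : (2%:R : F) = (2%:Z)%:~R by [].
    rewrite horner_map /= mulVf // subrr -intrM -[1]/((1%:Z)%:~R) -intrB => /intr_inj; lia.
  have [L LV] := lattice_exists OV bS.
  apply: (descendant_central OV LV A_div) => //.
  - move=> q q_pr q0 Oq; apply: (val_sV OV).
    have s2 : (2%:R : F)^-1 = 2%:R ^- 2 * 2%:R.
      by rewrite expr2 invfM -mulrA mulVf // mulr1.
    (* For [q = 2] the element is already [s^-1]; an odd [q] is a unit of [O], being 1 modulo 2. *)
    have [q2|q_odd] := even_prime q_pr; first by rewrite s2; move: Oq; rewrite q2.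
    have qE : q%:R = 1 - 2%:R * (- (q./2)%:R) :> F.
      by rewrite -{1}(odd_double_half q) q_odd natrD -mul2n natrM mulrN opprK.
    have Oqv : O (q%:R)^-1.
      by rewrite qE; apply: (valuation_unit OV); apply: (valN OV); apply: val_nat OV _.
    rewrite s2; apply: (valM OV); last exact: (val_s OV).
    by rewrite -[_ ^- 2](mulfK q0); apply: (valM OV).
  - by move=> z n Xz n_gt0 zn zroot; rewrite -[z]expr1; apply: (zroot 1%N n); rewrite ?mul1n ?F0.
  - move=> a x Xa; exact: (pchar0_no_shift F0 bS (XU _ Xa)).
have pA : p \in [pchar A] by rewrite pchar_lalg.
have p_pr := pcharf_prime pF.
have [Ftor|] := pselect (forall c : F, c != 0 -> torsion c).
  by move=> a _ y; apply: (findim_torsion_commutative pA A_div bS Ftor).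
move=> /existsNP [s /not_implyP [s0 sT]].
have [f|O OV] := valuation_ring_exists s0.
  apply/eqP => fE; apply: sT.
  suff [n n_gt0 sn] : torsion s^-1.
    by exists n => //; apply: invr_inj; rewrite -exprVn sn invr1.
  set y := s^-1 in fE *.
  (* From [f(s) = s^-1], multiplication by a power of [y] gives a monic relation for [y] over the
     prime field. *)
  pose l (i : 'I_(size f).+1) := y ^+ i.
  have [c cE] : nspan l (y ^+ (size f).+1).
    have -> : y ^+ (size f).+1 = \sum_(i < size f) y ^+ (size f - i) *~ f`_i.
      rewrite exprSr -{2}fE (horner_coef_wide _ (size_poly _ _)) mulr_sumr.
      apply: eq_bigr => i _; rewrite coef_map /= mulrCA mulrzl; congr (_ *~ _).
      rewrite -{1}(subnK (ltnW (ltn_ord i))) exprD -mulrA -exprMn mulVf //.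
      by rewrite expr1n mulr1.
    apply: nspan_sum => i _.
    have iS : (size f - i < (size f).+1)%N by rewrite ltnS leq_subr.
    have := nspan_gen l (Ordinal iS); rewrite /l /= => li.
    case: (f`_i) => m; first exact: nspanMn.
    by rewrite NegzE mulrNz; apply: (nspanN pF); apply: nspanMn.
  apply: (integral_torsion pF _ cE); by rewrite unitfE invr_eq0.
have [L LV] := lattice_exists OV bS.
have Xshift a x : X a -> a^-1 * x * a = x + 1 -> False.
  move=> Xa ax; have aU := XU _ Xa.
  have [y yT ay] := nontorsion_shift pA A_div aU s0 sT ax.
  apply: (descendant_no_shift pA A_div aU ay yT XG (Xdesc _ Xa)) => z Xz.
  by have [n n_gt0 zn] := Xtor a z Xa Xz; exists n => //; symmetry; apply: zn.
apply: (descendant_central OV LV A_div) => //.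
- move=> q q_pr q0 Oq; apply: (val_sV OV).
  (* A prime other than [p] has an inverse in the prime field, represented by a natural number and
     hence in [O]. *)
  have pq : coprime q p.
    rewrite prime_coprime //; apply/negP; rewrite dvdn_prime2 // => /eqP qp.
    by move: q0; rewrite qp (pcharf0 pF) eqxx.
  have [[u v] /= uv] := coprimeP _ (prime_gt0 q_pr) pq.
  have qu : q%:R^-1 = u%:R :> F.
    apply: (mulIf q0); rewrite mulVf // -natrM.
    have -> : (u * q)%N = (v * p + 1)%N by lia.
    by rewrite natrD natrM (pcharf0 pF) mulr0 add0r.
  have -> : s^-1 = s ^- 2 * q%:R * u%:R * s by rewrite -qu; field; rewrite s0 q0.
  apply: (valM OV); last exact: val_s OV.
  by apply: (valM OV) => //; apply: val_nat OV _.
- exact: (charp_root_central pF A_div XU XX Xshift).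
Qed.

(** * Reduction to the finite-dimensional case *)

Section CenterAlgebra.
Variable R : unitRingType.
Hypothesis R_div : forall x : R, x != 0 -> x \is a GRing.unit.

Lemma center_divring_closed : GRing.divring_closed (fun x : R => `[< central x >]).
Proof.
split=> [|x y /asboolP xC /asboolP yC|x y /asboolP xC /asboolP yC]; apply/asboolP => z.
- by rewrite mul1r mulr1.
- by rewrite mulrBl mulrBr xC yC.
- have [->|/R_div yU] := eqVneq y 0; first by rewrite invr0 mulr0 mul0r mulr0.
  have yV : y^-1 * z = z * y^-1.
    by apply: (mulrI yU); rewrite mulVKr // mulrA yC mulrK.
  by rewrite -mulrA yV !mulrA xC.
Qed.

Let C := {x : R | `[< central x >]}.
HB.instance Definition _ := SubChoice.on C.
HB.instance Definition _ :=
  GRing.SubChoice_isSubUnitRing.Build R _ C center_divring_closed.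
Lemma center_mulrC : @commutative C C *%R.
Proof. by move=> x y; apply: val_inj; apply: (asboolW (svalP x)). Qed.
HB.instance Definition _ := GRing.PzRing_hasCommutativeMul.Build C center_mulrC.
Lemma center_fieldP : GRing.field_axiom C.
Proof.
move=> x x0; have /R_div xU : val x != 0 by apply: contraNneq x0 => x0; apply/eqP/val_inj.
have xV : `[< central (val x)^-1 >].
  have [c1 _ cV] := center_divring_closed.
  by have := cV 1 (val x) c1 (valP x); rewrite div1r.
by apply/unitrP; exists (Sub (val x)^-1 xV); split; apply: val_inj; [apply: mulVr|apply: divrr].
Qed.
HB.instance Definition _ := GRing.ComUnitRing_isField.Build C center_fieldP.

Let A : Type := R.
HB.instance Definition _ := GRing.UnitRing.on A.
Let scale (c : C) (x : A) : A := val c * x.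
Lemma center_scaleA a b v : scale a (scale b v) = scale (a * b) v.
Proof. by rewrite /scale mulrA. Qed.
Lemma center_scale1 : left_id 1 scale. Proof. by move=> x; apply: mul1r. Qed.
Lemma center_scaleDr : right_distributive scale +%R. Proof. by move=> x y z; apply: mulrDr. Qed.
Lemma center_scaleDl v : {morph scale^~ v : a b / a + b}.
Proof. by move=> a b; rewrite /scale -mulrDl. Qed.
HB.instance Definition _ :=
  GRing.Zmodule_isLmodule.Build C A center_scaleA center_scale1 center_scaleDr center_scaleDl.
Lemma center_scaleAl (c : C) (x y : A) : c *: (x * y) = (c *: x) * y.
Proof. exact: mulrA. Qed.
HB.instance Definition _ := GRing.Lmodule_isLalgebra.Build C A center_scaleAl.
Lemma center_scaleAr (c : C) (x y : A) : c *: (x * y) = x * (c *: y).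
Proof. by rewrite /GRing.scale /= /scale mulrA (asboolW (svalP c)) mulrA. Qed.
HB.instance Definition _ := GRing.Lalgebra_isAlgebra.Build C A center_scaleAr.

Lemma center_findim_descendant_central (X : R -> Prop) :
  (exists n (b : 'I_n -> R), forall x, exists2 c : 'I_n -> R,
     forall i, central (c i) & x = \sum_i c i * b i) ->
  unit_subgroup X -> (forall a, X a -> descends a X) ->
  (forall a u, X a -> X u -> exists2 n, (0 < n)%N & central ((a^-1 * u^-1 * a * u) ^+ n)) ->
  forall a, X a -> central a.
Proof.
move=> [n [b bS]] XG Xdesc Xtor.
apply: (@findim_descendant_central (C : fieldType) (A : unitAlgType (C : fieldType)) X R_div);
  [|exact XG|move=> a /Xdesc|exact Xtor]; last first.
  elim=> [Y YU|Y Z YG _ IHY YZ|Y Z YG _ IHY YZ].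
  - exact: descends_units.
  - exact (@descends_commutator (A : unitAlgType (C : fieldType)) a Y Z YG IHY YZ).
  - exact (@descends_finite_index (A : unitAlgType (C : fieldType)) a Y Z YG IHY YZ).
exists n, b => x; have [c cC ->] := bS x.
by exists (fun i => Sub (c i) (asboolT (cC i))).
Qed.

End CenterAlgebra.

(** * Restriction to division subrings *)

Section DivisionSubring.
Variables (D : unitRingType) (K : D -> Prop).
Hypothesis D_div : is_division_ring D.
Hypothesis K_closed : Defs.divring_closed K.

Lemma divring_closed_bool : GRing.divring_closed (fun x : D => `[< K x >]).
Proof.
have [K0 [K1 [KN [KD [KM KV]]]]] := K_closed.
split=> [|x y /asboolP Kx /asboolP Ky|x y /asboolP Kx /asboolP Ky]; apply/asboolP => //.
  by apply: KD => //; apply: KN.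
by apply: KM => //; have [->|y0] := eqVneq y 0; [rewrite invr0|apply: KV].
Qed.

Let A := {x : D | `[< K x >]}.
HB.instance Definition _ := SubChoice.on A.
HB.instance Definition _ := GRing.SubChoice_isSubUnitRing.Build D _ A divring_closed_bool.

Lemma divring_sub_div (u : A) : u != 0 -> u \is a GRing.unit.
Proof.
move=> u0; have /D_div vU : sval u != 0 by apply: contraNneq u0 => v0; apply/eqP/val_inj.
have uV : `[< K (sval u)^-1 >].
  have [c1 _ cV] := divring_closed_bool.
  by have := cV 1 (sval u) c1 (svalP u); rewrite div1r.
apply/unitrP; exists (exist _ (sval u)^-1 uV).
by split; apply: val_inj; [apply: mulVr|apply: divrr].
Qed.

Lemma sval_unit (u : A) : (u \is a GRing.unit) = (sval u \is a GRing.unit).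
Proof.
apply/idP/idP => [|vU]; first exact: (rmorph_unit (val : A -> D)).
by apply: divring_sub_div; apply: contraTneq vU => ->; rewrite unitr0.
Qed.

Lemma sval_mul (u v : A) : sval (u * v) = sval u * sval v. Proof. by []. Qed.
Lemma sval_exp (u : A) n : sval (u ^+ n) = sval u ^+ n.
Proof. by elim: n => // n IHn; rewrite !exprS sval_mul IHn. Qed.
Lemma sval_inv (u : A) : sval u \is a GRing.unit -> sval u^-1 = (sval u)^-1.
Proof.
move=> vU; apply: (mulrI vU); rewrite -sval_mul !mulrV // sval_unit //.
Qed.

Lemma unit_subgroup_restrict (X : D -> Prop) :
  unit_subgroup X -> unit_subgroup (fun u : A => X (sval u)).
Proof.
move=> [X1 [XU [XM XV]]]; split; first exact: X1.
split; first by move=> u /XU; rewrite sval_unit.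
split=> [u v Xu Xv|u Xu]; first exact: XM.
by rewrite sval_inv; [apply: XV|apply: XU].
Qed.

(** Commutators with [a] stay in the subring, and a sequence in the subring is a sequence in [D], so
    each clause restricts. *)
Lemma descends_restrict (X : D -> Prop) (a : A) : sval a \is a GRing.unit ->
  descends (sval a) X -> descends a (fun u : A => X (sval u)).
Proof.
move=> aU; elim=> {X} [X XU|X Y XG _ IHX XY|X Y XG _ IHX XY].
- by apply: descends_units => u; rewrite sval_unit; apply: XU.
- apply: (descends_commutator (unit_subgroup_restrict XG)) => [|u Xu]; first exact: IHX.
  have vU : sval u \is a GRing.unit by case: XG => _ [XU _]; apply: XU.
  by rewrite !sval_mul !sval_inv //; apply: XY.
- apply: (descends_finite_index (unit_subgroup_restrict XG)) => [|f Xf]; first exact: IHX.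
  have [j [k [jk Yjk]]] := XY (fun i => sval (f i)) Xf; exists j, k; split; first exact: jk.
  have vU : sval (f j) \is a GRing.unit by case: XG => _ [XU _]; apply: XU.
  by rewrite sval_mul sval_inv.
Qed.

Lemma divring_descendant_central (X : D -> Prop) : findim_over_center K ->
  unit_subgroup X -> (forall a, X a -> descends a X) ->
  (forall a u, X a -> X u -> exists2 n, (0 < n)%N & central ((a^-1 * u^-1 * a * u) ^+ n)) ->
  forall a x, X a -> K a -> K x -> a * x = x * a.
Proof.
move=> [b [bK bS]] XG Xdesc Xtor a x Xa Ka Kx.
have XU u : X u -> u \is a GRing.unit by case: XG => _ [XU _]; apply: XU.
pose sub y (Ky : K y) : A := exist _ y (asboolT Ky).
suff /(_ (sub a Ka) Xa (sub x Kx)) : forall u : A, X (sval u) -> central u.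
  exact: (congr1 sval).
apply: (@center_findim_descendant_central A divring_sub_div (fun u => X (sval u))).
- exists (size b), (fun i : 'I_(size b) => sub b`_i (bK _ (mem_nth 0 (ltn_ord i)))) => y.
  have [c [cs [cC yE]]] := bS (sval y) (asboolW (svalP y)).
  have cC' (i : 'I_(size b)) : center_of K c`_i by apply/cC/mem_nth; rewrite cs.
  exists (fun i : 'I_(size b) => sub c`_i (cC' i).1) => [i z|].
    by apply: val_inj; apply: (cC' i).2; apply: asboolW (svalP z).
  apply: val_inj; rewrite [LHS]yE (raddf_sum (val : A -> D)).
  exact: eq_bigr.
- exact: unit_subgroup_restrict.
- by move=> u Xu; apply: descends_restrict; [apply: XU|apply: Xdesc].
- move=> u v Xu Xv; have [n n_gt0 nC] := Xtor _ _ Xu Xv; exists n => // y.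
  have E : sval ((u^-1 * v^-1 * u * v) ^+ n) =
      ((sval u)^-1 * (sval v)^-1 * sval u * sval v) ^+ n.
    by rewrite sval_exp !sval_mul !sval_inv; [|exact: XU|exact: XU].
  by apply: val_inj; have := nC (sval y); rewrite -E.
Qed.

End DivisionSubring.

Lemma gen_divring_closed (D : unitRingType) (S : seq D) : Defs.divring_closed (gen_divring S).
Proof.
split; [|split; [|split; [|split; [|split]]]].
- by move=> K [].
- by move=> K [_ []].
- by move=> x Kx K Kc KS; have [_ [_ [KN _]]] := Kc; apply: KN; apply: Kx.
- by move=> x y Kx Ky K Kc KS; have [_ [_ [_ [KD _]]]] := Kc; apply: KD; [apply: Kx|apply: Ky].
- by move=> x y Kx Ky K Kc KS; have [_ [_ [_ [_ [KM _]]]]] := Kc; apply: KM; [apply: Kx|apply: Ky].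
- by move=> x Kx x0 K Kc KS; have [_ [_ [_ [_ [_ KV]]]]] := Kc; apply: KV => //; apply: Kx.
Qed.

(** * Almost subnormal chains and the soluble series *)

Lemma almost_subnormal_trans (D : unitRingType) (H G K : D -> Prop) :
  almost_subnormal G K -> subgroup_of H G -> normal_in H G -> almost_subnormal H K.
Proof.
move=> [r [C [C0 [Cr CS]]]] HG nHG.
exists r.+1, (fun i => if (i <= r)%N then C i else H); rewrite leq0n ltnn; split=> //.
split=> // i; rewrite ltnS => ir; rewrite ir; case: ltngtP ir => // [ir|->] _.
  exact: CS.
by rewrite Cr; split=> //; left.
Qed.

Lemma almost_subnormal_descends (D : unitRingType) (X : D -> Prop) :
  almost_subnormal X (@units_of D) ->
  unit_subgroup X /\ forall a, X a -> descends a X.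
Proof.
move=> [r [C [C0 [Cr CS]]]].
have CG i : (i <= r)%N -> unit_subgroup (C i).
  case: i => [_|i /CS [[]] //]; rewrite C0 /units_of; split; first exact: unitr1.
  by split=> //; split=> [x y xU yU|x]; rewrite ?unitrMl ?unitrV.
split=> [|a Xa]; first by rewrite -Cr; apply: CG.
(* Membership of [a] in every term puts [a^-1 (u^-1 a u)] in the next term at a normal step. *)
have aC i : (i <= r)%N -> C i a.
  move=> ir; rewrite -(subKn ir); elim: (r - i)%N (leq_subr i r) => [|d IHd] dr.
    by rewrite subn0 Cr.
  have rd : (r - d.+1 < r)%N by rewrite ltn_subrL (leq_ltn_trans _ dr).
  have [[_ sub] _] := CS _ rd.
  by apply: sub; rewrite subnSK //; apply: IHd; apply: ltnW.
suff aD i : (i <= r)%N -> descends a (C i) by rewrite -Cr; apply: aD.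
elim: i => [_|i IHi ir]; first by apply: descends_units; rewrite C0.
have [[CSG _] [nC|[s [_ sC]]]] := CS i ir.
  apply: (descends_commutator (CG _ (ltnW ir)) (IHi (ltnW ir))) => u Cu.
  have [_ [_ [CM CV]]] := CSG; rewrite -!mulrA; apply: CM; first exact/CV/aC.
  by rewrite mulrA; apply: nC => //; apply: aC.
apply: (descends_finite_index (CG _ (ltnW ir)) (IHi (ltnW ir))) => f Cf.
have [_ [CU [CM CV]]] := CSG.
have /choice [y yP] : forall n, exists z, z \in s /\ C i.+1 (z^-1 * f n).
  by move=> n; have [z zs Cz] := sC _ (Cf n); exists z.
(* Two members of the sequence share a coset representative, which cancels in their quotient. *)
have [j [k [jk yjk]]] := pigeonhole (fun n => (yP n).1).
have fU n : f n \is a GRing.unit by have [_ [U _]] := CG _ (ltnW ir); apply: U.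
exists j, k; split=> //; have Ck := (yP k).2; have Cj := (yP j).2; rewrite -yjk in Ck.
have yVU : (y j)^-1 \is a GRing.unit.
  by have := CU _ Cj; rewrite unitrMl ?fU.
have -> : (f j)^-1 * f k = ((y j)^-1 * f j)^-1 * ((y j)^-1 * f k).
  by rewrite invrM // !mulrA mulrVK.
by apply: CM => //; apply: CV.
Qed.

Lemma almost_subnormal_central (D : unitRingType) (X : D -> Prop) :
  is_division_ring D -> weakly_locally_finite D -> almost_subnormal X (@units_of D) ->
  (forall a u, X a -> X u -> exists2 n, (0 < n)%N & central ((a^-1 * u^-1 * a * u) ^+ n)) ->
  forall a, X a -> central a.
Proof.
move=> D_div D_wlf /almost_subnormal_descends [XG Xdesc] Xtor a Xa x.
have Sin z : z \in [:: a; x] -> gen_divring [:: a; x] z by move=> zS K _; apply.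
apply: (divring_descendant_central D_div (gen_divring_closed _) (D_wlf _) XG Xdesc Xtor Xa).
  by apply: Sin; rewrite inE eqxx.
by apply: Sin; rewrite !inE eqxx orbT.
Qed.

Theorem theorem4p5 (D : unitRingType) (hD : is_division_ring D)
  (hwlf : weakly_locally_finite D) (G : D -> Prop)
  (hG : almost_subnormal G (@units_of D)) (hsp : soluble_by_periodic G) :
  forall g, G g -> forall x : D, g * x = x * g.
Proof.
have [H [HG [nHG [[_ [n [S [S0 [Sn SS]]]]] per]]]] := hsp.
have Ssub i : (i <= n)%N -> almost_subnormal (S i) (@units_of D).
  elim: i => [_|i IHi ir]; first by rewrite S0; apply: almost_subnormal_trans hG HG nHG.
  by have [Si [nSi _]] := SS i ir; apply: almost_subnormal_trans (IHi (ltnW ir)) Si nSi.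
have Scent i : (i <= n)%N -> forall a, S i a -> central a.
  (* Induction upwards from the trivial term [S n]: if [S i.+1] is central, commutators in [S i] are
     central already with exponent 1. *)
  move=> ir; rewrite -(subKn ir); elim: (n - i)%N (leq_subr i n) => [|d IHd] dn a.
    by rewrite subn0 => /Sn -> y; rewrite mul1r mulr1.
  have nd : (n - d.+1 < n)%N by rewrite ltn_subrL (leq_ltn_trans _ dn).
  have [_ [_ SC]] := SS _ nd.
  apply: (almost_subnormal_central hD hwlf (Ssub _ (ltnW nd))) => {}a u Sa Su.
  exists 1%N => //; rewrite expr1; apply: (IHd (ltnW dn)).
  by rewrite -subnSK //; apply: SC.
(* [H] is now central, and periodicity gives each commutator of [G] a power in [H]. *)
apply: (almost_subnormal_central hD hwlf hG) => a u Ga Gu.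
have [[_ [_ [GM GV]]] _] := almost_subnormal_descends hG.
have [|m [m_gt0 Hm]] := per (a^-1 * u^-1 * a * u).
  by do 3?[apply: (GM)] => //; apply: (GV).
by exists m => //; apply: (Scent 0%N) => //; rewrite S0.
Qed.
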